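(* Let ${\bf C}^{(1)},{\bf C}^{(2)}$ be two independent simple random walks on the 2-dimensional comb lattice $\mathbb{C}^2$, both starting from $(0,0)$, and let $D_2^{\mathbb{C}^2}(n)=d({\bf C}^{(1)}(n),{\bf C}^{(2)}(n))$, where $d$ is the graph distance on $\mathbb{C}^2$. Then for every $\epsilon>0$, almost surely there exists a (random) $n_0$ such that $$D_2^{\mathbb{C}^2}(n)>n^{1/4-\epsilon}\quad\text{for all } n\geq n_0.$$
   Context: The 2-dimensional comb lattice $\mathbb{C}^2$ is the graph obtained from the nearest-neighbour lattice $\mathbb{Z}^2$ by removing all horizontal edges off the $x$-axis. The simple random walk ${\bf C}(n)=(C_1(n),C_2(n))$ on $\mathbb{C}^2$ has transition probabilities $P({\bf C}(n+1)=(x,y\pm1)\mid{\bf C}(n)=(x,y))=\frac12$ if $y\neq0$, and $P({\bf C}(n+1)=(x\pm1,0)\mid{\bf C}(n)=(x,0))=P({\bf C}(n+1)=(x,\pm1)\mid{\bf C}(n)=(x,0))=\frac14$ (each of the indicated neighbours having the given probability). The graph distance $d(u,v)$ is the length of the shortest path in $\mathbb{C}^2$ from $u$ to $v$. *)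

(* Defs.v *)
From HB Require Import structures.
From mathcomp Require Import all_boot all_order all_algebra.
From mathcomp Require Import zify.
From mathcomp Require Import all_classical all_reals all_analysis.

Set Implicit Arguments.
Unset Strict Implicit.
Unset Printing Implicit Defensive.

Import Order.TTheory GRing.Theory Num.Theory.

Local Open Scope classical_set_scope.
Local Open Scope ring_scope.

Notation Z2 := (int * int)%type.

Definition Z2_adj : rel Z2 := fun u v =>
  (`|u.1 - v.1|%N + `|u.2 - v.2|%N == 1)%N.

(* An edge of Z^2 is horizontal when its endpoints have the same ordinate; it
   lies on the x-axis when that ordinate is 0. *)
Definition comb_adj : rel Z2 := fun u v =>
  Z2_adj u v && ~~ ((u.2 == v.2) && (u.2 != 0)).

Definition walk_of_length (u v : Z2) (n : nat) : Prop :=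
  exists p : seq Z2, [/\ path comb_adj u p, last u p = v & size p = n].

Lemma walk_cat u v w m n :
  walk_of_length u v m -> walk_of_length v w n -> walk_of_length u w (m + n).
Proof.
move=> [p [pP <- <-]] [q [qP <- <-]]; exists (p ++ q).
by rewrite cat_path pP qP last_cat size_cat.
Qed.

Lemma walk_edge u v : comb_adj u v -> walk_of_length u v 1.
Proof. by move=> uv; exists [:: v]; rewrite /= uv. Qed.

Lemma comb_connected u v : exists n, `[< walk_of_length u v n >].
Proof.
pose c a b := exists n, walk_of_length a b n.
have cT a b d : c a b -> c b d -> c a d.
  by move=> [m ab] [n bd]; exists (m + n)%N; exact: walk_cat ab bd.
have cE a b : comb_adj a b -> c a b by move=> /walk_edge; exists 1%N.
have c0 a : c a a by exists 0%N, [::].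
have vert x y : c (x, y) (x, 0) /\ c (x, 0) (x, y).
  elim: y => [//|n [h1 h2]|n [h1 h2]].
    by split; [apply: (cT _ (x, n%:Z)) => // |apply: (cT _ (x, n%:Z)) => //];
      apply: cE; rewrite /comb_adj /Z2_adj /=; lia.
  by split; [apply: (cT _ (x, - n%:Z)) => // |apply: (cT _ (x, - n%:Z)) => //];
    apply: cE; rewrite /comb_adj /Z2_adj /=; lia.
have horiz x : c (x, 0) (0, 0) /\ c (0, 0) (x, 0).
  elim: x => [//|n [h1 h2]|n [h1 h2]].
    by split; [apply: (cT _ (n%:Z, 0)) => // |apply: (cT _ (n%:Z, 0)) => //];
      apply: cE; rewrite /comb_adj /Z2_adj /=; lia.
  by split; [apply: (cT _ (- n%:Z, 0)) => // |apply: (cT _ (- n%:Z, 0)) => //];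
    apply: cE; rewrite /comb_adj /Z2_adj /=; lia.
suff [n uv] : c u v by exists n; apply/asboolP.
case: u v => [x y] [x' y'].
apply: (cT _ _ _ (vert x y).1); apply: (cT _ _ _ (horiz x).1).
exact: cT (horiz x').2 (vert x' y').2.
Qed.

Definition comb_dist (u v : Z2) : nat := ex_minn (comb_connected u v).

Definition comb_prob (R : realType) (u v : Z2) : R :=
  let: (x, y) := u in
  if y == 0 then
    if v \in [:: (x + 1, 0); (x - 1, 0); (x, 1); (x, -1)] then 1 / 4 else 0
  else
    if v \in [:: (x, y + 1); (x, y - 1)] then 1 / 2 else 0.

Section processes.
Context (d : measure_display) (T : measurableType d) (R : realType).
Variable P : probability T R.

(* Discrete-time process with values in Z^2, the latter carrying its discrete
   sigma-algebra. *)
Definition is_process (X : nat -> T -> Z2) : Prop :=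
  forall (n : nat) (A : set Z2), measurable (X n @^-1` A).

Definition history (X : nat -> T -> Z2) (n : nat) (s : nat -> Z2) : set T :=
  [set w | forall i, (i <= n)%N -> X i w = s i].

(* The Markov property, conditionally on the whole past, with the conditional
   probability multiplied out so that null pasts need no convention. *)
Definition comb_walk (x0 : Z2) (X : nat -> T -> Z2) : Prop :=
  [/\ is_process X,
      P (X 0%N @^-1` [set x0]) = 1%E &
      forall (n : nat) (s : nat -> Z2) (v : Z2),
        P (history X n s `&` X n.+1 @^-1` [set v]) =
        (P (history X n s) * (comb_prob R (s n) v)%:E)%E].

Definition process_sigma_algebra (X : nat -> T -> Z2) : set (set T) :=
  <<s [set E | exists (n : nat) (A : set Z2), E = X n @^-1` A] >>.

Definition independent_processes (X Y : nat -> T -> Z2) : Prop :=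
  forall E F : set T,
    process_sigma_algebra X E -> process_sigma_algebra Y F ->
    P (E `&` F) = (P E * P F)%E.

End processes.

(* Main.v *)
(* The heat kernel of the comb is explicit: (height, number of horizontal steps)
   has, by a discrete form of Levy's theorem, the law of (max S - S, max S) for a
   simple random walk S on Z, which the reflection principle computes. Hence
   P(C(n) = u) = O(n^(-3/4)) and P(|C_2(n)| <= H) = O(H n^(-1/2)).
   Split time into windows [M^4, 16 M^4) with M = 2^k, and call the walks close
   when their distance is at most r = s^2, where s^2 << M. Close walks are
   - both at height O(r): then they stay within O(r) of each other and of the
     axis for about r^2 steps; or
   - on the same tooth, at height between O(r) and O(M s): then, before leaving
     it, they are within distance 1 of each other at least about r times; or
   - on the same tooth, higher than that: likewise, at least about M s times.
   By the heat kernel bounds the mean numbers of times of these three kinds in the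
   window are O(r^3/M), O(s) and O(M), so by the Markov property the walks are
   close during the window with probability O(r/M + s/r + M/(M s)) =
   O(s^2/M + 1/s). For s^2 ~ n^(1/4 - eps) this is summable over k, and
   Borel-Cantelli applies. *)
Require Import Defs.
From mathcomp Require Import all_boot all_order all_algebra.
From mathcomp Require Import zify ring lra.
From mathcomp Require Import all_classical all_reals all_analysis.

Set Implicit Arguments.
Unset Strict Implicit.
Unset Printing Implicit Defensive.

Import Order.TTheory GRing.Theory Num.Theory.

Local Open Scope ring_scope.

(** * The simple random walk on Z *)

Section srw.
Variable R : realFieldType.

Fixpoint srw (n : nat) (k : int) : R :=
  if n is m.+1 then (srw m (k - 1) + srw m (k + 1)) / 2 else (k == 0)%:R.

Lemma srw_ge0 n k : 0 <= srw n k.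
Proof. by elim: n k => [|n IH] k /=; rewrite ?ler0n ?divr_ge0 ?addr_ge0. Qed.

Lemma srwN n k : srw n (- k) = srw n k.
Proof.
elim: n k => [|n IH] k /=; first by rewrite oppr_eq0.
have -> : - k - 1 = - (k + 1) :> int by lia.
have -> : - k + 1 = - (k - 1) :> int by lia.
by rewrite !IH [in RHS]addrC.
Qed.

Lemma srw_far n (k : int) : n%:Z < k -> srw n k = 0.
Proof.
elim: n k => [|n IH] k /= nk; first by case: eqP => //; lia.
by rewrite !IH ?addr0 ?mul0r //; lia.
Qed.

(** The ratio of consecutive binomial coefficients, multiplied out so that it also holds outside the
    support and for the wrong parity. *)
Lemma srw_ratio n (k : int) :
  (n%:R + k%:~R + 2) * srw n (k + 2) = (n%:R - k%:~R) * srw n k.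
Proof.
elim: n k => [|n IH] k /=.
  case: eqP => [h|_]; case: eqP => [h'|_] /=; try lia.
  - by rewrite mulr0 mulr1 (_ : k = - 2%:Z) ?rmorphN /=; [lra|lia].
  - by rewrite h' mulr0 mulr1; lra.
  - by rewrite !mulr0.
have h1 := IH (k + 1); have h2 := IH (k - 1).
have e1 : k + 1 + 2 = k + 2 + 1 :> int by lia.
have e2 : k - 1 + 2 = k + 1 :> int by lia.
have e3 : k + 2 - 1 = k + 1 :> int by lia.
rewrite e1 in h1; rewrite e2 in h2; rewrite e3.
rewrite -natr1; move: h1 h2; rewrite !intrD ?rmorphN /= => h1 h2.
lra.
Qed.

(** The induction at k = 0 calls the case k = -1, an equality by symmetry; hence this range of k. *)
Lemma srw_step2_le n (k : int) : -1 <= k -> srw n (k + 2) <= srw n k.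
Proof.
elim: n k => [|n IH] k k_ge /=.
  by case: eqP => // h; case: eqP => // _; lia.
rewrite ler_pM2r ?invr_gt0 //.
have -> : k + 2 - 1 = k + 1 :> int by lia.
rewrite [leRHS]addrC lerD2l.
case: (leP 0 k) => k0.
  apply: (@le_trans _ _ (srw n (k + 1))).
    have -> : k + 2 + 1 = k + 1 + 2 :> int by lia.
    by apply: IH; lia.
  have -> : k + 1 = k - 1 + 2 :> int by lia.
  by apply: IH; lia.
have -> : k - 1 = - (2%:R) :> int by lia.
by rewrite srwN; have -> : k + 2 + 1 = 2 :> int by lia.
Qed.

Lemma srw_even_shift_le n (k : int) (i : nat) :
  -1 <= k -> srw n (k + (2 * i)%:Z) <= srw n k.
Proof.
move=> k_ge; elim: i => [|i IH]; first by rewrite addr0.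
apply: le_trans IH.
have -> : k + (2 * i.+1)%:Z = k + (2 * i)%:Z + 2 by lia.
by apply: srw_step2_le; lia.
Qed.

(** The two parities feed each other: [srw n.+1 0 = srw n 1], and [srw_ratio] at 0 expresses
    [srw n.+1 1] through [srw n 0]; then (n+1)(n+3) <= (n+2)^2. This yields the order n^(-1/2)
    without Stirling's formula. *)
Lemma srw_center_le n :
  (n.+1)%:R * srw n 0 ^+ 2 <= 1 /\ (n.+2)%:R * srw n 1 ^+ 2 <= 1.
Proof.
elim: n => [|n [IH0 IH1]]; first by split=> /=; rewrite ?expr1n ?expr0n /=; lra.
split.
  by rewrite /= sub0r add0r srwN; rewrite (_ : _ / 2 = srw n 1) //; lra.
have h := srw_ratio n 0; rewrite addr0 subr0 add0r in h.
have n2 : 0 < n.+2%:R :> R by rewrite ltr0n.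
have -> : srw n.+1 1 = srw n 0 * n.+1%:R / n.+2%:R.
  have -> : srw n.+1 1 = (srw n 0 + srw n 2) / 2 by [].
  apply: (mulIf (lt0r_neq0 n2)); rewrite mulfVK ?lt0r_neq0 //.
  by rewrite -[n.+2%:R]natr1 -[n.+1%:R]natr1; lra.
have -> : n.+3%:R * (srw n 0 * n.+1%:R / n.+2%:R) ^+ 2 =
    (n.+1%:R * srw n 0 ^+ 2) * (n.+3%:R * n.+1%:R / n.+2%:R ^+ 2) :> R.
  by move: (lt0r_neq0 n2); move: n.+3%:R n.+2%:R n.+1%:R => a b c b0; field.
apply: le_trans (_ : 1 * 1 <= 1); last by rewrite mulr1.
apply: ler_pM => //; first by rewrite mulr_ge0 // exprn_ge0 // srw_ge0.
by rewrite ler_pdivrMr ?exprn_gt0 // mul1r -natrM -natrX ler_nat; lia.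
Qed.

Lemma srw_sqr_le n (k : int) : n.+1%:R * srw n k ^+ 2 <= 1.
Proof.
wlog k0 : k / 0 <= k.
  move=> H; case: (leP 0 k) => [/H //|k0]; rewrite -srwN; apply: H; lia.
have [h0 h1] := srw_center_le n.
have n0 : 0 < n.+1%:R :> R by rewrite ltr0n.
have sq x y : 0 <= x -> x <= y -> n.+1%:R * y ^+ 2 <= 1 -> n.+1%:R * x ^+ 2 <= 1 :> R.
  by move=> x0 xy; apply: le_trans; rewrite ler_pM2l // lerXn2r // nnegrE (le_trans x0).
have [e|e] : k = 0 + (2 * (`|k|./2))%:Z \/ k = 1 + (2 * (`|k|./2))%:Z.
  by case: (boolP (odd `|k|)); [right|left]; lia.
- by rewrite e; apply: sq h0; rewrite ?srw_ge0 // srw_even_shift_le.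
- rewrite e; apply: (@sq _ (srw n 1)); rewrite ?srw_ge0 ?srw_even_shift_le //.
  by apply: le_trans h1; apply: ler_wpM2r; rewrite ?sqr_ge0 // ler_nat.
Qed.

(** Root-free form of [srw_sqr_le], used with m = M^2 at times n >= M^4 and with m = M at times j >=
    M^2. *)
Lemma srw_le_inv n (m : nat) (k : int) :
  (0 < m)%N -> (m ^ 2 <= n.+1)%N -> srw n k <= m%:R^-1.
Proof.
move=> m0 mn; have mR : 0 < m%:R :> R by rewrite ltr0n.
rewrite -[leRHS]mul1r ler_pdivlMr //.
rewrite -(@ler_pXn2r _ 2) ?nnegrE ?mulr_ge0 ?srw_ge0 ?ler0n //.
rewrite expr1n exprMn; apply: le_trans (srw_sqr_le n k).
by rewrite mulrC; apply: ler_wpM2r; rewrite ?sqr_ge0 // -natrX ler_nat.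
Qed.

Lemma srw_sum_le1 n (s : seq int) : uniq s -> \sum_(k <- s) srw n k <= 1.
Proof.
elim: n s => [|n IH] s us /=.
  elim: s us => [|k s IHs] /=; first by rewrite big_nil.
  move=> /andP[ks us]; rewrite big_cons; case: eqP => [k0|_]; last first.
    by rewrite add0r IHs.
  rewrite big1_seq ?addr0 // => i /andP[_ si]; case: eqP => // i0.
  by move: ks; rewrite k0 -i0 si.
rewrite -mulr_suml big_split /= ler_pdivrMr // mul1r.
rewrite (_ : 2 = 1 + 1 :> R) //; apply: lerD.
  rewrite -(big_map (fun k => k - 1) predT (srw n)); apply: IH.
  by rewrite map_inj_uniq // => x y /addIr.
rewrite -(big_map (fun k => k + 1) predT (srw n)); apply: IH.
by rewrite map_inj_uniq // => x y /addIr.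
Qed.

(* By unimodality the k + 1 values of srw n at -k, -k + 2, ..., k are at least
   srw n k. *)
Lemma srw_mul_le1 n (k : nat) : k.+1%:R * srw n k%:Z <= 1.
Proof.
pose f (i : nat) : int := (2 * i)%:Z - k%:Z.
have us : uniq (map f (iota 0 k.+1)).
  by rewrite map_inj_uniq ?iota_uniq // => x y; rewrite /f; lia.
apply: le_trans (srw_sum_le1 n us).
rewrite big_map (_ : k.+1%:R * _ = \sum_(i <- iota 0 k.+1) srw n k%:Z); last first.
  by rewrite big_const_seq count_predT size_iota iter_addr_0 mulr_natl.
rewrite [leLHS]big_seq [leRHS]big_seq; apply: ler_sum => i.
rewrite mem_iota => /andP[_ ik]; rewrite /f.
case: (leqP k (2 * i)) => ki.
  rewrite [leLHS](_ : _ = srw n ((2 * i)%:Z - k%:Z + (2 * (k - i))%:Z)).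
    by rewrite srw_even_shift_le //; lia.
  by congr srw; lia.
rewrite -[leRHS]srwN [leLHS](_ : _ = srw n (- ((2 * i)%:Z - k%:Z) + (2 * i)%:Z)).
  by rewrite srw_even_shift_le //; lia.
by congr srw; lia.
Qed.

Definition gap n (k : int) : R := srw n k - srw n (k + 2).

Lemma gap_ge0 n (k : int) : -1 <= k -> 0 <= gap n k.
Proof. by move=> k1; rewrite subr_ge0 srw_step2_le. Qed.

(** By [srw_ratio], the gap times n + k + 2 equals 2 (k + 1) [srw n k], which [srw_mul_le1] bounds
    by 2. *)
Lemma gap_le n (k : nat) : gap n k%:Z <= 2 / n.+1%:R.
Proof.
have g0 : 0 <= gap n k%:Z by apply: gap_ge0; lia.
have := srw_ratio n k%:Z; rewrite -pmulrn => h.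
have hk := srw_mul_le1 n k; rewrite -natr1 in hk.
rewrite ler_pdivlMr ?ltr0n // -natr1.
apply: le_trans (_ : gap n k * (n%:R + k%:R + 2) <= _).
  by rewrite ler_wpM2l //; have := ler0n R k; lra.
by rewrite /gap; lra.
Qed.

Lemma gapS n (k : int) : gap n.+1 k = (gap n (k - 1) + gap n (k + 1)) / 2.
Proof.
rewrite /gap /=; have -> : k + 2 - 1 = k - 1 + 2 :> int by lia.
have -> : k + 2 + 1 = k + 1 + 2 :> int by lia.
by lra.
Qed.

Lemma gapN n : gap n (-1) = 0.
Proof. by rewrite /gap srwN subrr. Qed.

Lemma gap_far n (k : int) : n%:Z < k -> gap n k = 0.
Proof. by move=> nk; rewrite /gap !srw_far ?subrr //; lia. Qed.

Lemma gap_sum n (v : nat) (J : nat) :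
  \sum_(j < J) gap n (j + v)%N%:Z =
    srw n v + srw n v.+1 - srw n (J + v)%N - srw n (J + v).+1.
Proof.
elim: J => [|J IH]; first by rewrite big_ord0; lra.
rewrite big_ord_recr /= IH /gap.
have -> : (J + v)%N%:Z + 2 = (J.+1 + v).+1 :> int by lia.
have -> : (J + v).+1 = (J.+1 + v)%N by lia.
by lra.
Qed.

Definition sstep (g : int -> R) (k : int) : R := (g (k - 1) + g (k + 1)) / 2.

Lemma iter_sstep_indic n (s : seq int) (k : int) :
  iter n sstep (fun k => \sum_(c <- s) (c == k)%:R) k =
    \sum_(c <- s) srw n (c - k).
Proof.
elim: n k => [|n IH] k /=.
  by apply: eq_bigr => c _; rewrite subr_eq0.
rewrite /sstep !IH -big_split /= mulr_suml; apply: eq_bigr => c _.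
have -> : c - (k - 1) = c - k + 1 :> int by lia.
have -> : c - (k + 1) = c - k - 1 :> int by lia.
by lra.
Qed.

End srw.

(** * The heat kernel of the comb *)

Section avg.
Variable R : realFieldType.
Implicit Types (f g : Z2 -> R) (u w : Z2).

(** Transition operator of the comb walk: [iter n avg f u] is the mean of f(C(n)) for the walk
    started at u. *)
Definition avg f u : R :=
  if u.2 == 0 then
    (f (u.1 + 1, 0) + f (u.1 - 1, 0) + f (u.1, 1) + f (u.1, -1)) / 4
  else (f (u.1, u.2 + 1) + f (u.1, u.2 - 1)) / 2.

Lemma avg_le f g u : (forall w, f w <= g w) -> avg f u <= avg g u.
Proof. by move=> fg; rewrite /avg; case: ifP => _; rewrite ler_pM2r ?invr_gt0 ?lerD. Qed.

Lemma eq_avg f g u : f =1 g -> avg f u = avg g u.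
Proof. by move=> /funext ->. Qed.

Lemma eq_iter_avg n f g u : f =1 g -> iter n avg f u = iter n avg g u.
Proof. by move=> /funext ->. Qed.

Lemma avg_cst (c : R) u : avg (fun=> c) u = c.
Proof. by rewrite /avg; case: ifP => _; lra. Qed.

Lemma avgD f g u : avg (fun w => f w + g w) u = avg f u + avg g u.
Proof. by rewrite /avg; case: ifP => _; lra. Qed.

Lemma avgZ (c : R) f u : avg (fun w => c * f w) u = c * avg f u.
Proof. by rewrite /avg; case: ifP => _; lra. Qed.

Lemma iter_avg_le n f g u :
  (forall w, f w <= g w) -> iter n avg f u <= iter n avg g u.
Proof. by move=> fg; elim: n u => [|n IH] u //=; apply: avg_le. Qed.

Lemma iter_avg_cst n (c : R) u : iter n avg (fun=> c) u = c.
Proof.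
elim: n u => [//|n IH] u /=; rewrite -[RHS](avg_cst c u).
exact: eq_avg.
Qed.

Lemma iter_avgD n f g u :
  iter n avg (fun w => f w + g w) u = iter n avg f u + iter n avg g u.
Proof.
by elim: n u => [//|n IH] u /=; rewrite -avgD; apply: eq_avg.
Qed.

Lemma iter_avgZ n (c : R) f u :
  iter n avg (fun w => c * f w) u = c * iter n avg f u.
Proof.
by elim: n u => [//|n IH] u /=; rewrite -avgZ; apply: eq_avg.
Qed.

Lemma iter_avg_sum n (I : Type) (s : seq I) (F : I -> Z2 -> R) u :
  iter n avg (fun w => \sum_(i <- s) F i w) u = \sum_(i <- s) iter n avg (F i) u.
Proof.
elim: s => [|i s IH].
  rewrite big_nil -[RHS](iter_avg_cst n 0 u).
  by apply: eq_iter_avg => w; rewrite big_nil.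
rewrite big_cons -IH -iter_avgD.
by apply: eq_iter_avg => w; rewrite big_cons.
Qed.

Definition indic (v w : Z2) : R := (w == v)%:R.

(** Forward equation for the heat kernel: the indicator of the target is expanded over its
    predecessors, weighted by their transition probabilities to it. *)
Lemma avg_indic_axis (x : int) w :
  avg (indic (x, 0)) w = 1 / 4 * (indic (x - 1, 0) w + indic (x + 1, 0) w)
    + 1 / 2 * (indic (x, 1) w + indic (x, -1) w).
Proof.
case: w => x' y'; rewrite /avg /indic !xpair_eqE /=.
have -> : (x' + 1 == x) = (x' == x - 1) by lia.
have -> : (x' - 1 == x) = (x' == x + 1) by lia.
have -> : (y' + 1 == 0) = (y' == -1) by lia.
have -> : (y' - 1 == 0) = (y' == 1) by lia.
by case: (eqVneq y' 0) => [->|_] /=; rewrite ?andbT ?andbF /=; lra.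
Qed.

(* A height v > 0 is that of both (x, v) and (x, - v), which are equally likely. *)
Definition wt (y : int) : R := if y == 0 then 1 else 1 / 2.

(** The factor 1/(4 [wt]) is 1/4 for a predecessor on the axis and 1/2 otherwise; in this form it
    cancels the [wt] of the heat kernel. *)
Lemma avg_indic_tooth (x y : int) w : y != 0 ->
  avg (indic (x, y)) w =
    1 / (4 * wt (y - 1)) * indic (x, y - 1) w + 
    1 / (4 * wt (y + 1)) * indic (x, y + 1) w.
Proof.
case: w => x' y' y0; rewrite /avg /indic /wt !xpair_eqE /=.
have -> : (y' + 1 == y) = (y' == y - 1) by lia.
have -> : (y' - 1 == y) = (y' == y + 1) by lia.
case: (eqVneq y' 0) => [y'0|y'0] /=.
  have -> : (0 == y) = false by lia.
  rewrite !andbF /= y'0 !(eq_sym 0) (eq_sym 1) (eq_sym (-1)).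
  have -> : (y == 1) = (y - 1 == 0) by lia.
  have -> : (y == -1) = (y + 1 == 0) by lia.
  by case: (x' == x); case: eqP => h1; case: eqP => h2 /=; first [lra | lia].
case: (eqVneq (y - 1) 0) => [->|_]; case: (eqVneq (y + 1) 0) => [->|_];
  rewrite ?eqxx ?(negbTE y'0) ?andbF /=; lra.
Qed.

(* gap n (j + v) is the probability that a simple random walk S has max S = j and
   max S - S = v at time n, by reflection. *)
Definition heat_sum (J n : nat) (x : int) (v : nat) : R :=
  \sum_(j < J) gap R n (j + v)%N%:Z * srw R j x.

Lemma heat_sumS J n x v : heat_sum J n.+1 x v.+1 = (heat_sum J n x v + heat_sum J n x v.+2) / 2.
Proof.
rewrite /heat_sum -big_split mulr_suml; apply: eq_bigr => j _ /=.
rewrite gapS; have -> : (j + v.+1)%N%:Z - 1 = (j + v)%N :> int by lia.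
have -> : (j + v.+1)%N%:Z + 1 = (j + v.+2)%N :> int by lia.
lra.
Qed.

(** In terms of S, height 0 is reached either from one below the maximum (first term) or by a new
    maximum, which is one more horizontal step (second term). The summand j = 0 of the latter
    vanishes by [gapN], which shifts J by one. *)
Lemma heat_sum0 J n x : (n < J)%N ->
  heat_sum J.+1 n.+1 x 0 =
    heat_sum J.+1 n x 1 / 2 + (heat_sum J n (x - 1) 0 + heat_sum J n (x + 1) 0) / 4.
Proof.
move=> nJ; rewrite /heat_sum.
have -> : \sum_(j < J.+1) gap R n.+1 (j + 0)%N%:Z * srw R j x =
    (\sum_(j < J.+1) gap R n (j%:Z - 1) * srw R j x) / 2
    + (\sum_(j < J.+1) gap R n (j + 1)%N%:Z * srw R j x) / 2.
  rewrite -mulrDl -big_split mulr_suml; apply: eq_bigr => j _ /=.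
  rewrite gapS addn0 PoszD; lra.
rewrite addrC; congr (_ + _).
rewrite big_ord_recl /= sub0r gapN mul0r add0r -big_split !mulr_suml.
apply: eq_bigr => j _; rewrite /bump /= addn0.
have -> : (1 + j)%N%:Z - 1 = j by lia.
by lra.
Qed.

(** Both sides obey the same forward equation, obtained on the left from [iterSr]. Truncating at J >
    n loses nothing, as [gap n] vanishes beyond n. *)
Lemma heat_kernel J n (x y : int) : (n < J)%N ->
  iter n avg (indic (x, y)) (0, 0) = wt y * heat_sum J n x `|y|%N.
Proof.
elim: n J x y => [|n IH] [//|J] x y nJ.
  rewrite /= /indic /heat_sum big_ord_recl big1 ?addr0 => [|j _].
    rewrite /= /gap /= add0n /wt xpair_eqE !(eq_sym 0).
    have -> : (`|y|%N + 2 == 0 :> int) = false by lia.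
    have -> : (`|y|%N == 0 :> int) = (y == 0) by lia.
    by case: (y == 0); case: (x == 0) => /=; lra.
  by rewrite gap_far ?mul0r //= /bump; lia.
rewrite iterSr; case: (eqVneq y 0) => [->|y0].
  have -> : avg (indic (x, 0)) = fun w =>
      1 / 4 * (indic (x - 1, 0) w + indic (x + 1, 0) w)
      + 1 / 2 * (indic (x, 1) w + indic (x, -1) w).
    by apply: funext => w; apply: avg_indic_axis.
  rewrite iter_avgD !iter_avgZ !iter_avgD.
  rewrite (IH J (x - 1)) // (IH J (x + 1)) // !(IH J.+1) ?(ltnW nJ) //.
  rewrite /wt /= heat_sum0 //; lra.
have -> : avg (indic (x, y)) = fun w =>
    1 / (4 * wt (y - 1)) * indic (x, y - 1) w + 
    1 / (4 * wt (y + 1)) * indic (x, y + 1) w.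
  by apply: funext => w; apply: avg_indic_tooth.
rewrite iter_avgD !iter_avgZ !(IH J.+1) ?(ltnW nJ) //.
have wt_gt0 z : 0 < wt z by rewrite /wt; case: ifP => _; lra.
have e (a b : R) : 0 < a -> 1 / (4 * a) * (a * b) = b / 4.
  by move=> a0; field; rewrite lt0r_neq0.
rewrite !e // /wt (negbTE y0).
have [v yv] : exists v, `|y|%N = v.+1 by exists (`|y|.-1)%N; lia.
rewrite yv heat_sumS.
have [y_gt|y_lt] : 0 < y \/ y < 0 by lia.
  have -> : absz (y - 1) = v by lia.
  have -> : absz (y + 1) = v.+2 by lia.
  lra.
have -> : absz (y - 1) = v.+2 by lia.
have -> : absz (y + 1) = v by lia.
lra.
Qed.

(** Between the times M^2 and (M+1)^2 there are 2M + 1 <= 3M terms, each at most 1/M. *)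
Lemma srw_sum_time (M : nat) (x : int) : \sum_(j < M ^ 2) srw R j x <= 3 * M%:R.
Proof.
elim: M => [|M IH]; first by rewrite big_ord0 mulr0.
have [->|M0] := posnP M.
  rewrite (_ : 1 ^ 2 = 1)%N // big_ord_recl big_ord0 /=.
  by case: (_ == _) => /=; lra.
rewrite (_ : M.+1 ^ 2 = M ^ 2 + (2 * M).+1)%N; last by lia.
rewrite big_split_ord /= -[M.+1%:R]natr1 mulrDr lerD // mulr1.
apply: le_trans (_ : \sum_(j < (2 * M).+1) M%:R^-1 <= _).
  by apply: ler_sum => j _; apply: srw_le_inv => //; lia.
have MR : 0 < M%:R :> R by rewrite ltr0n.
rewrite sumr_const card_ord -[_ *+ _]mulr_natr mulrC ler_pdivrMr //.
by rewrite -natrM ler_nat; lia.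
Qed.

(** For j < M^2 the gaps are at most 2/M^4 and the [srw] factors sum to at most 3M. For j >= M^2
    those factors are at most 1/M and the gaps telescope to at most 2/M^2. The total is 6/M^3 +
    2/M^3. *)
Lemma heat_sum_le (M n : nat) (x : int) (v : nat) :
  (0 < M)%N -> (M ^ 4 <= n)%N -> heat_sum (M ^ 2 + n.+1) n x v <= 8 / M%:R ^+ 3.
Proof.
move=> M0 Mn; have MR : 0 < M%:R :> R by rewrite ltr0n.
rewrite /heat_sum big_split_ord /=.
have -> : 8 / M%:R ^+ 3 = 2 / M%:R ^+ 4 * (3 * M%:R) + 2 / M%:R ^+ 2 * M%:R^-1 :> R.
  by field; rewrite lt0r_neq0.
apply: lerD.
  apply: le_trans (_ : \sum_(j < M ^ 2) 2 / M%:R ^+ 4 * srw R j x <= _).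
    apply: ler_sum => j _; apply: ler_wpM2r; first exact: srw_ge0.
    apply: le_trans (gap_le _ _ _) _; rewrite ler_pM2l // lef_pV2 ?posrE ?exprn_gt0 ?ltr0n //.
    by rewrite -natrX ler_nat; lia.
  by rewrite -mulr_sumr ler_wpM2l ?srw_sum_time // divr_ge0 ?exprn_ge0.
apply: le_trans (_ : \sum_(j < n.+1) gap R n (j + (M ^ 2 + v))%N%:Z * M%:R^-1 <= _).
  apply: ler_sum => j _.
  rewrite (_ : M ^ 2 + j + v = j + (M ^ 2 + v))%N; last by lia.
  by apply: ler_wpM2l; [apply: gap_ge0; lia | apply: srw_le_inv => //; lia].
rewrite -mulr_suml ler_wpM2r ?invr_ge0 ?ler0n // gap_sum.
have h k : srw R n k <= (M%:R ^+ 2)^-1.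
  by rewrite -natrX; apply: srw_le_inv; rewrite ?expn_gt0 ?M0 //; lia.
have := h (M ^ 2 + v)%N%:Z; have := h (M ^ 2 + v).+1%:Z.
have := srw_ge0 R n (n.+1 + (M ^ 2 + v))%N%:Z.
have := srw_ge0 R n (n.+1 + (M ^ 2 + v)).+1%:Z.
lra.
Qed.

Lemma heat_kernel_le (M n : nat) v :
  (0 < M)%N -> (M ^ 4 <= n)%N -> iter n avg (indic v) (0, 0) <= 8 / M%:R ^+ 3.
Proof.
case: v => x y M0 Mn; rewrite (heat_kernel (J := M ^ 2 + n.+1)); last by lia.
apply: le_trans (heat_sum_le x `|y|%N M0 Mn).
rewrite ler_piMl //; last by rewrite /wt; case: ifP => _; lra.
apply: sumr_ge0 => j _; rewrite mulr_ge0 ?srw_ge0 // gap_ge0 //; lia.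
Qed.

(* Identifying k with -1 - k, the distance to the axis becomes a simple random
   walk on Z. *)
Lemma avg_fold (g : int -> R) u : (forall k, g (-1 - k) = g k) ->
  avg (fun w => g `|w.2|%N%:Z) u = sstep g `|u.2|%N%:Z.
Proof.
move=> gN; case: u => x y; rewrite /avg /sstep /=; case: eqP => [->|y0] /=.
  have <- : g (-1) = g 0 by rewrite -gN.
  have -> : g (0%:Z + 1) = g 1%:Z by [].
  have -> : g (0%:Z - 1) = g (-1) by [].
  lra.
have [y_gt|y_lt] : 0 < y \/ y < 0 by lia.
  have -> : (absz (y + 1))%:Z = `|y|%N%:Z + 1 by lia.
  have -> : (absz (y - 1))%:Z = `|y|%N%:Z - 1 by lia.
  lra.
have -> : (absz (y + 1))%:Z = `|y|%N%:Z - 1 by lia.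
have -> : (absz (y - 1))%:Z = `|y|%N%:Z + 1 by lia.
lra.
Qed.

Lemma iter_avg_fold n (g : int -> R) u : (forall k, g (-1 - k) = g k) ->
  iter n avg (fun w => g `|w.2|%N%:Z) u = iter n (@sstep R) g `|u.2|%N%:Z.
Proof.
elim: n g u => [//|n IH] g u gN; rewrite !iterSr -IH.
  by apply: eq_iter_avg => w; apply: avg_fold.
move=> k; rewrite /sstep addrC -[in RHS](gN (k - 1)) -[in RHS](gN (k + 1)).
have -> : -1 - k + 1 = -1 - (k - 1) :> int by lia.
by have -> : -1 - k - 1 = -1 - (k + 1) :> int by lia.
Qed.

Lemma iter_sstep_le n (g h : int -> R) k : (forall k, g k <= h k) ->
  iter n (@sstep R) g k <= iter n (@sstep R) h k.
Proof.
by move=> gh; elim: n k => [|n IH] k //=; rewrite /sstep ler_pM2r ?invr_gt0 ?lerD.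
Qed.

(** Unfolding by k -> -1 - k turns the strip into the 2H + 2 points of [-H-1, H], each of
    probability at most 1/M^2 for the simple random walk. *)
Lemma heat_strip_le (M n H : nat) : (0 < M)%N -> (M ^ 4 <= n)%N ->
  iter n avg (fun w => (`|w.2| <= H)%N%:R) (0, 0) <= (2 * H + 2)%N%:R / M%:R ^+ 2.
Proof.
move=> M0 Mn.
pose inH (k : int) : bool := - H.+1%:Z <= k <= H%:Z.
pose g (k : int) : R := (inH k)%:R.
pose s : seq int := [seq i%:Z - H.+1%:Z | i <- iota 0 (2 * H + 2)].
have -> : (fun w : Z2 => (`|w.2| <= H)%N%:R) = fun w => g `|w.2|%N%:Z.
  by apply: funext => w; rewrite /g /inH; congr (_%:R); congr nat_of_bool; lia.
rewrite iter_avg_fold => [|k]; last first.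
  by rewrite /g /inH; congr (_%:R); congr nat_of_bool; lia.
apply: le_trans (_ : iter n (@sstep R) (fun k => \sum_(c <- s) (c == k)%:R) 0 <= _).
  apply: iter_sstep_le => k; rewrite /g; case: (boolP (inH k)) => [kH|_]; last first.
    by apply: sumr_ge0 => c _; rewrite ler0n.
  have ks : k \in s.
    move: kH => /andP[h1 h2].
    by apply/mapP; exists (absz (k + H.+1%:Z)); [rewrite mem_iota; lia | lia].
  rewrite (big_rem k) //= eqxx lerDl; apply: sumr_ge0 => c _; exact: ler0n.
rewrite iter_sstep_indic.
apply: le_trans (_ : \sum_(c <- s) (M%:R ^+ 2)^-1 <= _).
  apply: ler_sum => c _; rewrite -natrX; apply: srw_le_inv; last by lia.
  by rewrite expn_gt0 M0.
by rewrite big_const_seq count_predT size_map size_iota iter_addr_0 mulr_natl.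
Qed.

End avg.

(** * Pairs of independent walks *)

Section avg2.
Variable R : realType.
Implicit Types (F G phi : Z2 * Z2 -> R) (s : Z2 * Z2).

Definition nbrs (u : Z2) : seq Z2 :=
  if u.2 == 0 then [:: (u.1 + 1, 0); (u.1 - 1, 0); (u.1, 1); (u.1, -1)]
  else [:: (u.1, u.2 + 1); (u.1, u.2 - 1)].

Lemma avgE (f : Z2 -> R) u : avg f u = \sum_(v <- nbrs u) comb_prob R u v * f v.
Proof.
case: u => x y; rewrite /avg /nbrs /comb_prob /=; case: ifP => _;
  rewrite !big_cons big_nil !inE !eqxx ?orbT /=; lra.
Qed.

Definition avg2 F s : R := avg (fun u => avg (fun v => F (u, v)) s.2) s.1.

Lemma avg2_le F G s : (forall s', F s' <= G s') -> avg2 F s <= avg2 G s.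
Proof. by move=> FG; apply: avg_le => u; apply: avg_le => v. Qed.

Lemma eq_avg2 F G s : F =1 G -> avg2 F s = avg2 G s.
Proof. by move=> /funext ->. Qed.

Lemma avg2_cst (c : R) s : avg2 (fun=> c) s = c.
Proof.
rewrite /avg2 -[RHS](avg_cst c s.1); apply: eq_avg => u; exact: avg_cst.
Qed.

Lemma avg2D F G s : avg2 (fun s' => F s' + G s') s = avg2 F s + avg2 G s.
Proof. by rewrite /avg2 -avgD; apply: eq_avg => u; rewrite avgD. Qed.

Lemma avg2Z (c : R) F s : avg2 (fun s' => c * F s') s = c * avg2 F s.
Proof. by rewrite /avg2 -avgZ; apply: eq_avg => u; rewrite avgZ. Qed.

Lemma iter_avg2_le n F G s :
  (forall s', F s' <= G s') -> iter n avg2 F s <= iter n avg2 G s.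
Proof. by move=> FG; elim: n s => [|n IH] s //=; apply: avg2_le. Qed.

Lemma iter_avg2D n F G s :
  iter n avg2 (fun s' => F s' + G s') s = iter n avg2 F s + iter n avg2 G s.
Proof. by elim: n s => [//|n IH] s /=; rewrite -avg2D; apply: eq_avg2. Qed.

Lemma iter_avg2Z n (c : R) F s :
  iter n avg2 (fun s' => c * F s') s = c * iter n avg2 F s.
Proof. by elim: n s => [//|n IH] s /=; rewrite -avg2Z; apply: eq_avg2. Qed.

Lemma avg_iter_swap n (G : Z2 -> Z2 -> R) a b :
  avg (fun v => iter n (@avg R) (G^~ v) a) b = iter n (@avg R) (fun u => avg (G u) b) a.
Proof.
rewrite avgE; have -> : (fun u => avg (G u) b) =
    fun u => \sum_(v <- nbrs b) comb_prob R b v * G u v.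
  by apply: funext => u; rewrite avgE.
by rewrite iter_avg_sum; apply: eq_bigr => v _; rewrite iter_avgZ.
Qed.

(** Averaging over one walk commutes with averaging over the other, so the n steps of each can be
    done separately; this reduces pairs to the heat kernel of one walk. *)
Lemma iter_avg2 n F s :
  iter n avg2 F s =
    iter n (@avg R) (fun u => iter n (@avg R) (fun v => F (u, v)) s.2) s.1.
Proof.
elim: n F s => [|n IH] F [a b] //.
rewrite iterSr IH (iterSr n (@avg R)); apply: eq_iter_avg => u.
rewrite -(avg_iter_swap n (fun v' u' => avg (fun v => F (u', v)) v')).
by apply: eq_avg => u'; rewrite iterSr.
Qed.

(* hit E k s: probability that the pair of walks started at s is in E at some time
   i <= k. visits phi T s: mean of the sum of phi over its positions at times
   i < T. *)
Fixpoint hit (E : pred (Z2 * Z2)) (k : nat) s : R :=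
  if E s then 1 else if k is k'.+1 then avg2 (hit E k') s else 0.

Fixpoint visits phi (T : nat) s : R :=
  if T is T'.+1 then phi s + avg2 (visits phi T') s else 0.

Lemma visits_ge0 phi T s : (forall s', 0 <= phi s') -> 0 <= visits phi T s.
Proof.
move=> phi0; elim: T s => [//|T IH] s /=.
by rewrite addr_ge0 // -[leLHS](avg2_cst 0 s) avg2_le.
Qed.

Lemma visits_leS phi T s :
  (forall s', 0 <= phi s') -> visits phi T s <= visits phi T.+1 s.
Proof.
move=> phi0; elim: T s => [|T IH] s; first exact: visits_ge0.
by rewrite [leLHS]/= [leRHS]/= lerD2l avg2_le.
Qed.

Lemma visits_le_time phi T T' s :
  (forall s', 0 <= phi s') -> (T <= T')%N -> visits phi T s <= visits phi T' s.
Proof.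
move=> phi0 /subnK <-; elim: (T' - T)%N => [//|k IH].
by rewrite addSn; apply: le_trans IH _; apply: visits_leS.
Qed.

Lemma visits_scale_le (c : R) phi psi T T' s :
  (forall s', 0 <= psi s') -> (forall s', c * phi s' <= psi s') ->
  (T <= T')%N -> c * visits phi T s <= visits psi T' s.
Proof.
move=> psi0 phi_psi TT'; apply: le_trans (visits_le_time s psi0 TT').
elim: {T' TT'} T s => [|T IH] s /=; first by rewrite mulr0.
by rewrite mulrDr lerD // -avg2Z avg2_le.
Qed.

(** Strong Markov property at the first entrance into E: from there on the mean of the visits is at
    least 1, and the T further steps fit into k + T. *)
Lemma hit_le_visits (E : pred (Z2 * Z2)) phi T k s :
  (forall s', 0 <= phi s') -> (forall s', E s' -> 1 <= visits phi T s') ->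
  hit E k s <= visits phi (k + T) s.
Proof.
move=> phi0 ET; elim: k s => [|k IH] s /=; case: ifP => [Es|_].
- exact: ET.
- exact: visits_ge0.
- apply: le_trans (ET s Es) _.
  by apply: (@visits_le_time _ T (k + T).+1); rewrite // -addSn leq_addl.
- by rewrite -[leLHS]add0r lerD // avg2_le.
Qed.

Lemma iter_visits_le phi (n T : nat) (B : R) s :
  (forall m, (n <= m)%N -> iter m avg2 phi s <= B) ->
  iter n avg2 (visits phi T) s <= T%:R * B.
Proof.
elim: T n => [|T IH] n phiB.
  rewrite mul0r; elim: n s {phiB} => [//|n IHn] s /=.
  by rewrite -[leRHS](avg2_cst 0 s) avg2_le.
rewrite iter_avg2D -iterSr -natr1 mulrDl mul1r addrC lerD ?phiB //.
by apply: IH => m nm; apply: phiB; apply: ltnW.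
Qed.

(** Given the position u of the first walk, the second is in [S u] with probability at most kappa
    times the heat kernel bound; the strip bound for the first walk gives the last factor. *)
Lemma iter_avg2_strip_le (M H kappa n : nat) (S : Z2 -> seq Z2) phi :
  (0 < M)%N -> (M ^ 4 <= n)%N -> (forall u, size (S u) <= kappa)%N ->
  (forall u v, phi (u, v) <=
     (`|u.2| <= H)%N%:R * \sum_(c <- S u) indic R c v) ->
  iter n avg2 phi ((0, 0), (0, 0)) <=
    kappa%:R * (8 / M%:R ^+ 3) * ((2 * H + 2)%N%:R / M%:R ^+ 2).
Proof.
move=> M0 Mn Sk phiS; rewrite iter_avg2 /=.
have b0 : 0 <= 8 / M%:R ^+ 3 :> R by rewrite divr_ge0 ?exprn_ge0 ?ler0n.
apply: le_trans (_ : iter n (@avg R)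
    (fun u => kappa%:R * (8 / M%:R ^+ 3) * (`|u.2| <= H)%N%:R) (0, 0) <= _).
  apply: iter_avg_le => u.
  apply: le_trans (iter_avg_le n (0, 0) (phiS u)) _.
  rewrite iter_avgZ mulrC ler_wpM2r ?ler0n // iter_avg_sum.
  apply: le_trans (_ : \sum_(c <- S u) 8 / M%:R ^+ 3 <= _).
    by apply: ler_sum => c _; apply: heat_kernel_le.
  rewrite big_const_seq count_predT iter_addr_0 -[_ *+ size _]mulr_natl ler_wpM2r //.
  by rewrite ler_nat.
rewrite iter_avgZ ler_wpM2l ?mulr_ge0 ?ler0n //.
exact: heat_strip_le.
Qed.

Lemma iter_avg2_plane_le (M kappa n : nat) (S : Z2 -> seq Z2) phi :
  (0 < M)%N -> (M ^ 4 <= n)%N -> (forall u, size (S u) <= kappa)%N ->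
  (forall u v, phi (u, v) <= \sum_(c <- S u) indic R c v) ->
  iter n avg2 phi ((0, 0), (0, 0)) <= kappa%:R * (8 / M%:R ^+ 3).
Proof.
move=> M0 Mn Sk phiS; rewrite iter_avg2 /=.
have b0 : 0 <= 8 / M%:R ^+ 3 :> R by rewrite divr_ge0 ?exprn_ge0 ?ler0n.
rewrite -[leRHS](iter_avg_cst n _ (0, 0)).
apply: iter_avg_le => u.
apply: le_trans (iter_avg_le n (0, 0) (phiS u)) _.
rewrite iter_avg_sum.
apply: le_trans (_ : \sum_(c <- S u) 8 / M%:R ^+ 3 <= _).
  by apply: ler_sum => c _; apply: heat_kernel_le.
rewrite big_const_seq count_predT iter_addr_0 -[_ *+ size _]mulr_natl ler_wpM2r //.
by rewrite ler_nat.
Qed.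

End avg2.

(** * Lower bounds for the time that two close walks spend near each other *)

Section sojourn.
Variable R : realType.
Implicit Types (phi : Z2 * Z2 -> R).

Lemma absz_le_natr (z : int) (n : nat) : (`|z| <= n)%N = (`|z%:~R| <= n%:R :> R).
Proof. by rewrite -intr_norm -abszE -pmulrn ler_nat. Qed.

(** The quadratic function [Psi] is at least 1 outside the box of size 100 r, and its mean grows by
    at most 3q per step, one q for each of its three squares. So during r^2 steps [1 - Psi], a lower
    bound for phi, stays bounded below on average. *)
Lemma low_visits phi (r : nat) (u v : Z2) : (0 < r)%N ->
  (forall s, 0 <= phi s) ->
  (forall u' v', (`|u'.1 - v'.1| <= 100 * r)%N -> (`|u'.2| <= 100 * r)%N ->
     (`|v'.2| <= 100 * r)%N -> 1 <= phi (u', v')) ->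
  (`|u.1 - v.1| <= r)%N -> (`|u.2| <= 48 * r)%N -> (`|v.2| <= 49 * r)%N ->
  r%:R ^+ 2 / 4 <= visits phi (r ^ 2) (u, v).
Proof.
move=> r0 phi0 phi1 uvx uy vy.
have rR : 0 < r%:R :> R by rewrite ltr0n.
pose q : R := (100 * r%:R) ^- 2.
have q0 : 0 < q by rewrite invr_gt0 exprn_gt0 ?mulr_gt0.
pose Psi (s : Z2 * Z2) : R :=
  q * ((s.1.1 - s.2.1)%:~R ^+ 2 + s.1.2%:~R ^+ 2 + s.2.2%:~R ^+ 2).
have Psi0 s : 0 <= Psi s.
  by apply: mulr_ge0; [exact: ltW | rewrite !addr_ge0 ?sqr_ge0].
have Psi_avg s : avg2 Psi s <= Psi s + 3 * q.
  case: s => [[x1 y1] [x2 y2]]; rewrite /avg2 /avg /Psi /=.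
  by case: eqP => [->|_]; case: eqP => [->|_] /=; rewrite ?intrD ?rmorphN /=; nra.
have sqb (z : int) (n : nat) : (`|z| <= n)%N -> z%:~R ^+ 2 <= n%:R ^+ 2 :> R.
  by rewrite absz_le_natr -[z%:~R ^+ 2]real_normK ?num_real // ler_sqr ?nnegrE.
have phiPsi s : 1 - Psi s <= phi s.
  case: (leP 1 (Psi s)) => [h|h]; first by apply: le_trans (phi0 s); lra.
  case: s h => u' v' h.
  have h' : (u'.1 - v'.1)%:~R ^+ 2 + u'.2%:~R ^+ 2 + v'.2%:~R ^+ 2 < (100 * r%:R) ^+ 2 :> R.
    by move: h; rewrite /Psi /q mulrC ltr_pdivrMr ?mul1r // exprn_gt0 // mulr_gt0.
  have bnd (z : int) : z%:~R ^+ 2 < (100 * r%:R) ^+ 2 :> R -> (`|z| <= 100 * r)%N.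
    rewrite absz_le_natr -[z%:~R ^+ 2]real_normK ?num_real // ltr_sqr ?nnegrE ?mulr_ge0 ?ler0n //.
    by rewrite natrM => /ltW.
  apply: le_trans (_ : 1 <= _); first by have := Psi0 (u', v'); lra.
  apply: phi1; apply: bnd; apply: le_lt_trans h'.
  - by rewrite -addrA lerDl addr_ge0 ?sqr_ge0.
  - by rewrite addrAC lerDr addr_ge0 ?sqr_ge0.
  - by rewrite lerDr addr_ge0 ?sqr_ge0.
have main T s : T%:R * (1 - Psi s - 3 * q * T%:R) <= visits phi T s.
  elim: T s => [|T IH] s /=; first by rewrite mul0r.
  have T0 : 0 <= T%:R :> R by rewrite ler0n.
  have step : T%:R * (1 - (Psi s + 3 * q) - 3 * q * T%:R) <= avg2 (visits phi T) s.
    apply: le_trans (avg2_le _ IH).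
    rewrite avg2Z ler_wpM2l //.
    have -> : (fun s' => 1 - Psi s' - 3 * q * T%:R) =
        fun s' => (1 - 3 * q * T%:R) + (-1) * Psi s'.
      by apply: funext => s'; lra.
    by rewrite avg2D avg2_cst avg2Z; have := Psi_avg s; lra.
  apply: le_trans (lerD (phiPsi s) step); rewrite -natr1; nra.
apply: le_trans (main _ _).
(* Initially [Psi] is at most (1 + 48^2 + 49^2) / 100^2 < 1/2, and 3 q r^2 = 3/10000, which leaves
   more than 1/4. *)
have h1 := sqb _ _ uvx; have h2 := sqb _ _ uy; have h3 := sqb _ _ vy.
rewrite natrX ler_wpM2l ?exprn_ge0 ?ler0n //.
have qr : q * r%:R ^+ 2 = 1 / 10000 by rewrite /q; field; rewrite lt0r_neq0.
have : Psi (u, v) <= q * (r%:R ^+ 2 + (48 * r)%N%:R ^+ 2 + (49 * r)%N%:R ^+ 2).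
  by rewrite ler_pM2l // !lerD.
rewrite !natrM !exprMn; lra.
Qed.

(* With w and z the difference and the (recentred) sum of the two heights, Phi is
   nonpositive once |w| or |z| reaches 4 rho, and its mean increases by q at each
   step with |w| > 1, hence Phi is a lower bound for the mean number of steps with
   |w| <= 1. *)
Lemma tooth_visits phi (x y1 y2 : int) (rho : nat) : (0 < rho)%N ->
  (forall s, 0 <= phi s) ->
  (forall a b : int, (`|a - b| <= 1)%N -> (`|a| <= 2 * `|y1|)%N ->
     1 <= phi ((x, a), (x, b))) ->
  (12 * rho <= `|y1|)%N -> (4 * `|y1 - y2| <= rho)%N ->
  rho%:R / 4 <= visits phi (4 * rho ^ 2) ((x, y1), (x, y2)).
Proof.
move=> rho0 phi0 phi1 y1_ge y12.
have rR : 1 <= rho%:R :> R by rewrite ler1n.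
pose q : R := (8 * rho%:R)^-1.
have qr : q * rho%:R = 1 / 8 by rewrite /q; field; rewrite lt0r_neq0 // (lt_le_trans ltr01).
have q0 : 0 < q by rewrite invr_gt0 mulr_gt0 // (lt_le_trans ltr01).
have q8 : q <= 1 / 8 by nra.
pose Phi (w z : R) : R := rho%:R / 2 - `|w| + q * (w ^+ 2 - z ^+ 2 / 2).
(* One step changes w and z by at most 2, so starting below 4 rho only |w| <= 4 rho + 2 occurs,
   where q w^2 <= (3/4)|w|. *)
have Phi_le w z : `|w| <= 4 * rho%:R + 2 -> Phi w z <= rho%:R / 2 /\
    (4 * rho%:R <= `|w| \/ 4 * rho%:R <= `|z| -> Phi w z <= 0).
  rewrite /Phi -[w ^+ 2]real_normK ?num_real // -[z ^+ 2]real_normK ?num_real //.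
  have := normr_ge0 w; have := normr_ge0 z.
  move: `|w| `|z| => W Z Z0 W0 Wle.
  have e1 : q * W ^+ 2 <= W * (3 / 4).
    apply: le_trans (_ : W * (q * (4 * rho%:R + 2)) <= _); last first.
      by rewrite ler_wpM2l //; lra.
    by rewrite expr2 mulrCA ler_wpM2l // ler_wpM2l // ltW.
  have e2 : 0 <= q * Z ^+ 2 by rewrite mulr_ge0 ?sqr_ge0 ?ltW.
  split; first lra.
  move=> [WZ|WZ]; first lra.
  have : q * (4 * rho%:R) ^+ 2 <= q * Z ^+ 2.
    by rewrite (ler_wpM2l (ltW q0)) // ler_sqr ?nnegrE ?mulr_ge0 ?ler0n.
  have -> : q * (4 * rho%:R) ^+ 2 = 16 * (q * rho%:R) * rho%:R by ring.
  rewrite qr; lra.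
pose z (a b : int) : int := a + b - y1 - y2.
(* Since 4 q rho^2 = rho/2, the correction -rho/2 + q T is nonpositive throughout, makes the case T
   = 0 true because Phi <= rho/2, and vanishes at the final time. *)
have main T : (T <= 4 * rho ^ 2)%N -> forall a b : int,
    (`|a - b| <= 4 * rho + 2)%N -> (`|z a b| <= 4 * rho + 2)%N ->
    Phi (a - b)%:~R (z a b)%:~R - rho%:R / 2 + q * T%:R
      <= visits phi T ((x, a), (x, b)).
  elim: T => [|T IH] TT a b wle zle; have wleR := wle;
    rewrite absz_le_natr natrD natrM in wleR; have [hle h0] := Phi_le _ (z a b)%:~R wleR.
    by rewrite /= mulr0; lra.
  have [ext|int] : ((4 * rho <= `|a - b|)%N \/ (4 * rho <= `|z a b|)%N) \/
      ((`|a - b| < 4 * rho)%N /\ (`|z a b| < 4 * rho)%N) by clear; lia.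
    apply: le_trans (visits_ge0 _ _ phi0).
    have : Phi (a - b)%:~R (z a b)%:~R <= 0.
      by apply: h0; case: ext => h; [left|right];
        rewrite -natrM -intr_norm -abszE -pmulrn ler_nat.
    have : q * T.+1%:R <= q * (4 * rho ^ 2)%N%:R.
      by rewrite (ler_wpM2l (ltW q0)) // ler_nat.
    have -> : q * (4 * rho ^ 2)%N%:R = 4 * (q * rho%:R) * rho%:R.
      by rewrite natrM natrX; ring.
    rewrite qr; lra.
  case: int => wlt zlt; rewrite /z in zlt.
  (* As |y1| >= 12 rho, having |w| and |z| below 4 rho keeps both heights away from 0: neither walk
     has left the tooth. *)
  have a0 : (a == 0) = false by clear -wlt zlt y1_ge y12; lia.
  have b0 : (b == 0) = false by clear -wlt zlt y1_ge y12; lia.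
  have IH' a' b' (W Z : R) : (a' - b')%:~R = W -> (z a' b')%:~R = Z ->
      (`|a' - b'| <= 4 * rho + 2)%N -> (`|z a' b'| <= 4 * rho + 2)%N ->
      Phi W Z - rho%:R / 2 + q * T%:R <= visits phi T ((x, a'), (x, b')).
    by move=> <- <- h1 h2; apply: IH => //; apply: ltnW.
  pose W : R := (a - b)%:~R; pose Z : R := (z a b)%:~R.
  have shift (m n k : int) : m = n + k -> m%:~R = n%:~R + k%:~R :> R.
    by move=> ->; rewrite intrD.
  have v1 : Phi W (Z + 2) - rho%:R / 2 + q * T%:R <=
      visits phi T ((x, a + 1), (x, b + 1)).
    apply: IH'; [by congr (_%:~R); clear; lia | |
      clear -wlt; lia | rewrite /z; clear -zlt; lia].
    by rewrite (shift _ (z a b) 2%:Z) //; rewrite /z; clear; lia.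
  have v2 : Phi (W + 2) Z - rho%:R / 2 + q * T%:R <=
      visits phi T ((x, a + 1), (x, b - 1)).
    apply: IH'; [by rewrite (shift _ (a - b) 2%:Z) //; clear; lia | |
      clear -wlt; lia | rewrite /z; clear -zlt; lia].
    by congr (_%:~R); rewrite /z; clear; lia.
  have v3 : Phi (W - 2) Z - rho%:R / 2 + q * T%:R <=
      visits phi T ((x, a - 1), (x, b + 1)).
    apply: IH'; [by rewrite (shift _ (a - b) (- 2%:Z)) ?rmorphN //; clear; lia | |
      clear -wlt; lia | rewrite /z; clear -zlt; lia].
    by congr (_%:~R); rewrite /z; clear; lia.
  have v4 : Phi W (Z - 2) - rho%:R / 2 + q * T%:R <=
      visits phi T ((x, a - 1), (x, b - 1)).
    apply: IH'; [by congr (_%:~R); clear; lia | |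
      clear -wlt; lia | rewrite /z; clear -zlt; lia].
    by rewrite (shift _ (z a b) (- 2%:Z)) ?rmorphN //; rewrite /z; clear; lia.
  rewrite [leRHS]/= /avg2 /avg /= a0 b0.
  (* W moves by 2 or -2 with probability 1/4 each. The mean of |W| grows only near its kink, by at
     most 1, which phi pays for. The quadratic part gains 2q from w^2 and loses q from z^2/2. *)
  have kink : `|W + 2| + `|W - 2| <= 2 * `|W| + 4 * phi ((x, a), (x, b)).
    case: (leqP `|a - b| 1) => [wle1|wgt1].
      have := phi1 a b wle1 ltac:(clear -wlt zlt y1_ge y12; lia).
      have := ler_normD W 2; have := ler_normB W 2.
      rewrite [`|2 : R|]ger0_norm //; lra.
    have p0 := phi0 ((x, a), (x, b)).
    have [Wge|Wle] : 2 <= W \/ W <= - 2.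
      have [h|h] : 2%:Z <= a - b \/ a - b <= - 2%:Z by clear -wgt1; lia.
        by left; rewrite /W (_ : 2 = 2%:Z%:~R) // ler_int.
      by right; rewrite /W -[2]/(2%:Z%:~R) -rmorphN ler_int.
    - by clear -Wge p0; rewrite !ger0_norm; lra.
    - by clear -Wle p0; rewrite !ler0_norm; lra.
  move: v1 v2 v3 v4; rewrite -/W -/Z /Phi -[T.+1%:R]natr1.
  lra.
apply: le_trans (main _ (leqnn _) y1 y2 _ _); rewrite /z;
  [|by clear -y12; lia|by clear; lia].
rewrite (_ : y1 + y2 - y1 - y2 = 0); last by clear; lia.
rewrite /Phi natrM natrX expr0n /= mul0r subr0.
have -> : q * (4 * rho%:R ^+ 2) = 4 * (q * rho%:R) * rho%:R :> R by ring.
have : 4 * `|(y1 - y2)%:~R| <= rho%:R :> R.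
  by rewrite -intr_norm -abszE -pmulrn -natrM ler_nat.
have : 0 <= q * (y1 - y2)%:~R ^+ 2 by rewrite mulr_ge0 ?sqr_ge0 ?ltW.
rewrite qr; lra.
Qed.

End sojourn.

(** * Lower bounds for the graph distance *)

Lemma comb_dist_lipschitz (g : Z2 -> int) u v :
  (forall a b, comb_adj a b -> (absz (g a - g b) <= 1)%N) ->
  (absz (g u - g v) <= comb_dist u v)%N.
Proof.
move=> lip; rewrite /comb_dist; case: ex_minnP => n /asboolP[p [pP <- <-]] _.
elim: p u pP => [|w p IH] u /=; first by rewrite subrr.
by move=> /andP[/lip uw /IH]; move: uw; lia.
Qed.

(** Each bound comes from a 1-Lipschitz function. For the third it is the height on the tooth of u,
    extended by 0: that tooth can only be left through the axis. *)
Lemma comb_dist_ge u v :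
  [/\ (absz (u.1 - v.1) <= comb_dist u v)%N, (absz (u.2 - v.2) <= comb_dist u v)%N
    & u.1 != v.1 -> (`|u.2| <= comb_dist u v)%N].
Proof.
split.
- by apply: (@comb_dist_lipschitz fst) => -[x y] [x' y']; rewrite /comb_adj /Z2_adj /=; lia.
- by apply: (@comb_dist_lipschitz snd) => -[x y] [x' y']; rewrite /comb_adj /Z2_adj /=; lia.
move=> uv; pose g (w : Z2) : int := if w.1 == u.1 then `|w.2|%N else 0.
have : (absz (g u - g v) <= comb_dist u v)%N.
  apply: comb_dist_lipschitz => -[x y] [x' y']; rewrite /comb_adj /Z2_adj /g /=.
  by case: ifP => h1; case: ifP => h2; lia.
by rewrite /g eqxx eq_sym (negbTE uv) subr0 absz_nat.
Qed.

(** * Probability that the walks become close during one time window *)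

Section window.
Variable R : realType.

Lemma indic_sum_ge1 (S : seq Z2) v : v \in S -> 1 <= \sum_(c <- S) indic R c v.
Proof.
move=> vS; rewrite (big_rem v) //= {1}/indic eqxx lerDl.
by apply: sumr_ge0 => c _; apply: ler0n.
Qed.

Lemma indic_sum_ge0 (S : seq Z2) v : 0 <= \sum_(c <- S) indic R c v.
Proof. by apply: sumr_ge0 => c _; apply: ler0n. Qed.

Definition box_pair (r : nat) (p : Z2 * Z2) : bool :=
  [&& absz (p.1.1 - p.2.1) <= 100 * r, `|p.1.2| <= 100 * r & `|p.2.2| <= 100 * r]%N.

Definition tooth_pair (p : Z2 * Z2) : bool :=
  (p.1.1 == p.2.1) && (absz (p.1.2 - p.2.2) <= 1)%N.

Definition low_tooth_pair (H : nat) (p : Z2 * Z2) : bool :=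
  tooth_pair p && (`|p.1.2| <= H)%N.

Definition origin2 := ((0, 0), (0, 0)) : Z2 * Z2.

(** For a given u, the box leaves at most (200 r + 1)^2 <= (201 r)^2 positions for v, listed in
    [S]. *)
Lemma iter_avg2_box_le (M r n : nat) : (0 < M)%N -> (0 < r)%N -> (M ^ 4 <= n)%N ->
  iter n (@avg2 R) (fun p => (box_pair r p)%:R) origin2 <=
    ((201 * r) ^ 2)%N%:R * (8 / M%:R ^+ 3) * ((202 * r)%N%:R / M%:R ^+ 2).
Proof.
move=> M0 r0 Mn; have MR : 0 < M%:R :> R by rewrite ltr0n.
pose S (u : Z2) : seq Z2 :=
  [seq (u.1 + i%:Z - (100 * r)%:Z, j%:Z - (100 * r)%:Z)
     | i <- iota 0 (201 * r), j <- iota 0 (201 * r)].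
apply: le_trans (_ : _ <= ((201 * r) ^ 2)%N%:R * (8 / M%:R ^+ 3) *
    ((2 * (100 * r) + 2)%N%:R / M%:R ^+ 2)) _; last first.
  rewrite ler_wpM2l ?mulr_ge0 ?invr_ge0 ?exprn_ge0 ?ler0n //.
  by rewrite ler_wpM2r ?invr_ge0 ?exprn_ge0 ?ler0n // ler_nat; lia.
apply: (iter_avg2_strip_le (S := S)) => // [u|u v].
  by rewrite size_allpairs size_iota mulnn.
rewrite /box_pair /=; case: (boolP [&& _, _ & _]) => [/and3P[h1 h2 h3]|_].
  rewrite h2 mul1r; apply: indic_sum_ge1.
  apply/allpairsP; exists (absz (v.1 - u.1 + (100 * r)%:Z), absz (v.2 + (100 * r)%:Z)).
  split; [rewrite /= mem_iota; lia | rewrite /= mem_iota; lia |].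
  by case: v h1 h3 => a b /= h1 h3; congr pair; lia.
by rewrite mulr_ge0 ?ler0n ?indic_sum_ge0.
Qed.

Let S3 (u : Z2) : seq Z2 := [:: (u.1, u.2 - 1); (u.1, u.2); (u.1, u.2 + 1)].

Let tooth_pair_mem u v : tooth_pair (u, v) -> v \in S3 u.
Proof.
case: u v => x y [x' y']; rewrite /tooth_pair /= => /andP[/eqP <- h].
by rewrite /S3 !inE !xpair_eqE eqxx /=; lia.
Qed.

Lemma iter_avg2_low_tooth_le (M H n : nat) : (0 < M)%N -> (M ^ 4 <= n)%N ->
  iter n (@avg2 R) (fun p => (low_tooth_pair H p)%:R) origin2 <=
    3 * (8 / M%:R ^+ 3) * ((2 * H + 2)%N%:R / M%:R ^+ 2).
Proof.
move=> M0 Mn; apply: (iter_avg2_strip_le (kappa := 3) (S := S3)) => // u v.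
rewrite /low_tooth_pair; case: (boolP (_ && _)) => [/andP[/tooth_pair_mem h1 ->]|_].
  by rewrite mul1r indic_sum_ge1.
by rewrite mulr_ge0 ?ler0n ?indic_sum_ge0.
Qed.

Lemma iter_avg2_tooth_le (M n : nat) : (0 < M)%N -> (M ^ 4 <= n)%N ->
  iter n (@avg2 R) (fun p => (tooth_pair p)%:R) origin2 <= 3 * (8 / M%:R ^+ 3).
Proof.
move=> M0 Mn; apply: (iter_avg2_plane_le (kappa := 3) (S := S3)) => // u v.
case: (boolP (tooth_pair _)) => [/tooth_pair_mem h|_]; last exact: indic_sum_ge0.
exact: indic_sum_ge1.
Qed.

Definition close (r : nat) : pred (Z2 * Z2) := fun p => (comb_dist p.1 p.2 <= r)%N.

(** With r = s^2, the weights are the inverses of the mean sojourn times r^2/4, r and M s/4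
    guaranteed in the three kinds of close position, so that every close pair collects a total cost
    of at least 1. *)
Definition cost (s M : nat) (p : Z2 * Z2) : R :=
  4 / (s ^ 2)%N%:R ^+ 2 * (box_pair (s ^ 2) p)%:R
  + ((s ^ 2)%N%:R^-1 * (low_tooth_pair (24 * M * s) p)%:R
  + 4 / (M * s)%N%:R * (tooth_pair p)%:R).

Lemma cost_ge0 s M p : 0 <= cost s M p.
Proof. by rewrite /cost !addr_ge0 // mulr_ge0 ?ler0n // ?divr_ge0 ?invr_ge0 ?exprn_ge0 ?ler0n. Qed.

Lemma visits_cost_ge1 (s M : nat) p : (0 < s)%N -> (4 * s <= M)%N ->
  close (s ^ 2) p -> 1 <= visits (cost s M) (M ^ 4) p.
Proof.
case: p => u v s0 sM; rewrite /close /= => duv.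
have [d1 d2 d3] := comb_dist_ge u v.
have sR : 0 < s%:R :> R by rewrite ltr0n.
have MR : 0 < M%:R :> R by rewrite ltr0n; lia.
set r := (s ^ 2)%N in duv *.
have r0 : (0 < r)%N by rewrite expn_gt0 s0.
have rR : 0 < r%:R :> R by rewrite ltr0n.
have scale (c : R) (b : pred (Z2 * Z2)) T :
    (forall p, c * (b p)%:R <= cost s M p) -> (T <= M ^ 4)%N -> 
    c * visits (fun p => (b p)%:R) T (u, v) <= visits (cost s M) (M ^ 4) (u, v).
  by move=> h1 h2; apply: visits_scale_le => // p; apply: cost_ge0.
have pV p : 0 <= 4 / r%:R ^+ 2 * (box_pair r p)%:R :> R.
  by rewrite mulr_ge0 ?divr_ge0 ?exprn_ge0 ?ler0n.
have pM p : 0 <= r%:R^-1 * (low_tooth_pair (24 * M * s) p)%:R :> R.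
  by rewrite mulr_ge0 ?invr_ge0 ?ler0n.
have pH p : 0 <= 4 / (M * s)%N%:R * (tooth_pair p)%:R :> R.
  by rewrite mulr_ge0 ?divr_ge0 ?ler0n.
have s4M : (256 * s ^ 4 <= M ^ 4)%N.
  by rewrite (_ : 256 = 4 ^ 4)%N // -expnMn leq_exp2r.
case: (leqP `|u.2| (48 * r)) => [low|high].
  apply: le_trans (scale (4 / r%:R ^+ 2) (box_pair r) (r ^ 2)%N _ _); last first.
  - by rewrite /r; lia.
  - by move=> p; rewrite /cost lerDl addr_ge0.
  have := @low_visits R (fun p => (box_pair r p)%:R) r u v r0.
  move=> /(_ _ _ _ low) h.
  rewrite -[leLHS](_ : 4 / r%:R ^+ 2 * (r%:R ^+ 2 / 4) = 1); last first.
    by field; rewrite lt0r_neq0.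
  rewrite ler_wpM2l ?divr_ge0 ?exprn_ge0 ?ler0n //; apply: h => //; try lia.
  by move=> u' v' h1 h2 h3; rewrite /box_pair h1 h2 h3.
(* On different teeth the path would descend to the axis, forcing |u.2| <= r. *)
have uv1 : u.1 = v.1.
  apply/eqP; apply: contraLR high => /d3 h; rewrite -leqNgt; lia.
case: u v uv1 {d3} duv d1 d2 scale high => x y1 [_ y2] /= <- duv _ d2 scale high.
have bR (b : bool) : b -> 1 <= b%:R :> R by move=> ->.
(* [tooth_visits] is applied with rho = 4r, where 12 rho is the threshold 48 r, or with rho = M s,
   where it is 12 M s. In the first case heights stay below 2|y1| <= 24 M s. Both durations fit into
   M^4 because 4 s <= M. *)
case: (leqP `|y1| (12 * M * s)) => [mid|top].
  apply: le_trans (scale r%:R^-1 (low_tooth_pair (24 * M * s)) (4 * (4 * r) ^ 2)%N _ _).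
  - have := @tooth_visits R (fun p => (low_tooth_pair (24 * M * s) p)%:R) x y1 y2 (4 * r).
    move=> h; rewrite -[leLHS](_ : r%:R^-1 * ((4 * r)%N%:R / 4) = 1); last first.
      by rewrite natrM; field; rewrite lt0r_neq0.
    rewrite ler_wpM2l ?invr_ge0 ?ler0n //; apply: h => //; try lia.
    move=> a b ab ay; apply: bR; rewrite /low_tooth_pair /tooth_pair /= eqxx ab /=.
    lia.
  - by move=> p; rewrite /cost addrCA lerDl addr_ge0.
  - by rewrite /r; lia.
apply: le_trans (scale (4 / (M * s)%N%:R) tooth_pair (4 * (M * s) ^ 2)%N _ _).
- have := @tooth_visits R (fun p => (tooth_pair p)%:R) x y1 y2 (M * s).
  move=> h; rewrite -[leLHS](_ : 4 / (M * s)%N%:R * ((M * s)%N%:R / 4) = 1); last first.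
    by rewrite natrM; field; rewrite !lt0r_neq0.
  rewrite ler_wpM2l ?divr_ge0 ?ler0n //; apply: h => //; try lia.
  + by move=> a b ab ay; apply: bR; rewrite /tooth_pair /= eqxx ab.
  + apply: leq_trans (_ : 4 * r <= _)%N; first by lia.
    by rewrite /r -mulnn mulnA leq_mul2r sM orbT.
- by move=> p; rewrite /cost addrA lerDr addr_ge0.
- rewrite expnMn; apply: leq_trans (_ : M ^ 2 * (4 * s ^ 2) <= _)%N; first by lia.
  have -> : (M ^ 4 = M ^ 2 * M ^ 2)%N by rewrite -expnD.
  rewrite leq_mul2l.
  by apply/orP; right; have := leq_mul sM sM; lia.
Qed.

Definition window_cst : R :=
  16 * (4 * 201 ^+ 2 * 8 * 202) + 16 * (24 * 50 + 4 * 24).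

Lemma hit_window_le (s M : nat) : (0 < s)%N -> (4 * s <= M)%N ->
  iter (M ^ 4) (@avg2 R) (hit R (close (s ^ 2)) (15 * M ^ 4)) origin2 <=
    window_cst * (s%:R ^+ 2 / M%:R + s%:R^-1).
Proof.
move=> s0 sM.
have sR : 0 < s%:R :> R by rewrite ltr0n.
have M0 : (0 < M)%N by lia.
have MR : 0 < M%:R :> R by rewrite ltr0n.
apply: le_trans (iter_avg2_le _ _
  (fun p => hit_le_visits (15 * M ^ 4) p (@cost_ge0 s M) (fun p' => visits_cost_ge1 s0 sM))) _.
pose B : R := 4 * 201 ^+ 2 * 8 * 202 * (s%:R ^+ 2 / M%:R ^+ 5) + 24 * 50 / (s%:R * M%:R ^+ 4)
  + 4 * 24 / (s%:R * M%:R ^+ 4).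
apply: le_trans (iter_visits_le (B := B) _ _) _.
  move=> m Mm; rewrite /cost !iter_avg2D !iter_avg2Z addrA /B; apply: lerD; [apply: lerD|].
  - have h := iter_avg2_box_le M0 (_ : 0 < s ^ 2)%N Mm.
    have {}h := h ltac:(by rewrite expn_gt0 s0).
    apply: le_trans (ler_wpM2l _ h) _; first by rewrite divr_ge0 ?exprn_ge0 ?ler0n.
    rewrite !(natrX, natrM) le_eqVlt; apply/orP; left; apply/eqP; field.
    by rewrite !lt0r_neq0.
  - apply: le_trans (ler_wpM2l _ (iter_avg2_low_tooth_le _ M0 Mm)) _.
      by rewrite invr_ge0 ler0n.
    apply: le_trans (_ : _ <= (s ^ 2)%N%:R^-1 * (3 * (8 / M%:R ^+ 3) *
        ((50 * M * s)%N%:R / M%:R ^+ 2))) _.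
      rewrite ler_wpM2l ?invr_ge0 ?ler0n // ler_wpM2l ?mulr_ge0 ?invr_ge0 ?exprn_ge0 ?ler0n //.
      rewrite ler_wpM2r ?invr_ge0 ?exprn_ge0 ?ler0n // ler_nat.
      by have := leq_mul M0 s0; lia.
    rewrite !(natrX, natrM) le_eqVlt; apply/orP; left; apply/eqP; field.
    by rewrite !lt0r_neq0.
  - apply: le_trans (ler_wpM2l _ (iter_avg2_tooth_le M0 Mm)) _.
      by rewrite divr_ge0 ?ler0n.
    rewrite !natrM le_eqVlt; apply/orP; left; apply/eqP; field.
    by rewrite !lt0r_neq0.
(* The window has length 15 M^4; the additional M^4 accommodates the sojourn after a late
   encounter. *)
rewrite (_ : 15 * M ^ 4 + M ^ 4 = 16 * M ^ 4)%N; last by lia.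
have -> : (16 * M ^ 4)%N%:R * B = 16 * (4 * 201 ^+ 2 * 8 * 202) * (s%:R ^+ 2 / M%:R)
    + 16 * (24 * 50 + 4 * 24) * s%:R^-1.
  by rewrite /B natrM natrX; field; rewrite !lt0r_neq0.
have sub (c1 c2 a b : R) : 0 <= c1 -> 0 <= c2 -> 0 <= a -> 0 <= b ->
    c1 * a + c2 * b <= (c1 + c2) * (a + b) by nra.
by apply: sub; rewrite ?mulr_ge0 ?addr_ge0 ?invr_ge0 ?exprn_ge0 ?ler0n.
Qed.

End window.

(** * The two walks as processes *)

Local Open Scope classical_set_scope.
Local Open Scope ring_scope.

Lemma historyS d (T : measurableType d) (X : nat -> T -> Z2) n s :
  history X n.+1 s = history X n s `&` X n.+1 @^-1` [set s n.+1].
Proof.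
apply/seteqP; split=> w /=.
  by move=> h; split; [move=> i ni; apply: h; apply: leqW | apply: h].
by move=> [h1 h2] i; rewrite leq_eqVlt ltnS => /predU1P[->//|/h1].
Qed.

Lemma history0 d (T : measurableType d) (X : nat -> T -> Z2) s :
  history X 0 s = X 0%N @^-1` [set s 0%N].
Proof.
apply/seteqP; split=> w /=; first by apply.
by move=> h i; rewrite leqn0 => /eqP ->.
Qed.

Lemma history_measurable d (T : measurableType d) (X : nat -> T -> Z2) n s :
  is_process X -> measurable (history X n s).
Proof.
move=> mX; elim: n => [|n IH]; first by rewrite history0; apply: mX.
by rewrite historyS; apply: measurableI => //; apply: mX.
Qed.

(** This is [history_measurable] on T equipped with the sigma-algebra generated by X. *)
Lemma history_process_sigma_algebra d (T : measurableType d) (X : nat -> T -> Z2) n s :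
  process_sigma_algebra X (history X n s).
Proof.
pose G := [set E | exists (n : nat) (A : set Z2), E = X n @^-1` A].
apply: (@history_measurable _ (g_sigma_algebraType G)) => m A.
by apply: sub_sigma_algebra; exists m, A.
Qed.

Definition extend (n : nat) (s : nat -> Z2) (v : Z2) : nat -> Z2 :=
  fun i => if (i <= n)%N then s i else v.

Lemma history_extend d (T : measurableType d) (X : nat -> T -> Z2) n s v :
  history X n.+1 (extend n s v) = history X n s `&` X n.+1 @^-1` [set v].
Proof.
rewrite historyS {2}/extend ltnn; congr (_ `&` _).
by apply/seteqP; split=> w h i ni; rewrite h // /extend ni.
Qed.

Lemma comb_prob_eq0 (R : realType) u v : v \notin nbrs u -> comb_prob R u v = 0.
Proof. by case: u => x y; rewrite /nbrs /comb_prob /=; case: ifP => _ /negbTE ->. Qed.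

Section single_walk.
Context (d : measure_display) (T : measurableType d) (R : realType).
Variable P : probability T R.
Local Open Scope ereal_scope.

Lemma measure_le_fibres (A : set T) (Y : T -> Z2) (N : seq Z2) :
  (forall B : set Z2, measurable (Y @^-1` B)) -> measurable A ->
  P A <= \sum_(a <- N) P (A `&` Y @^-1` [set a])
         + P (A `&` Y @^-1` [set v | v \notin N]).
Proof.
move=> mY mA; elim: N => [|a N IH].
  rewrite big_nil add0e (_ : _ `&` _ = A) //.
  by apply/seteqP; split=> w; [case|].
apply: le_trans IH _; rewrite big_cons addeAC [leRHS]addeC leeD2l //.
apply: le_trans (measureU2 _ _ _); last 2 first.
- exact: measurableI.
- exact: measurableI.
apply: le_measure; rewrite ?inE; [exact: measurableI| |].
  by apply: measurableU; exact: measurableI.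
move=> w [Aw /= YN]; case: (eqVneq (Y w) a) => [Ya|Ya]; [left|right]; split=> //=.
by rewrite inE negb_or Ya.
Qed.

(** The Markov property speaks of single targets only; the forbidden ones are countably many,
    enumerated here by [unpickle], and each is null. *)
Lemma walk_step_null (x0 : Z2) (X : nat -> T -> Z2) n s : comb_walk P x0 X ->
  P (history X n s `&` X n.+1 @^-1` [set v | v \notin nbrs (s n)]) = 0.
Proof.
move=> [mX _ markov]; apply/negligibleP.
  by apply: measurableI; [exact: history_measurable | exact: mX].
pose B (m : nat) : set T :=
  if unpickle m is Some v then
    if v \in nbrs (s n) then set0 else history X n s `&` X n.+1 @^-1` [set v]
  else set0.
apply: (@negligibleS _ _ _ _ (\bigcup_m B m)).
  move=> w [hw /= Xw]; exists (pickle (X n.+1 w)); first exact: I.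
  by rewrite /B pickleK (negbTE Xw).
apply: negligible_bigcup => m; rewrite /B.
case: unpickle => [v|]; last exact: negligible_set0.
case: (boolP (v \in _)) => [_|vN]; first exact: negligible_set0.
apply/negligibleP.
  by apply: measurableI; [exact: history_measurable | exact: mX].
by have := markov n s v; rewrite comb_prob_eq0 // mule0.
Qed.

End single_walk.

Definition encounter (T : Type) (C1 C2 : nat -> T -> Z2) (E : pred (Z2 * Z2))
    (n k : nat) : set T :=
  [set w | exists2 i, (i <= k)%N & E (C1 (n + i)%N w, C2 (n + i)%N w)].

(** * Comparison of the two processes with the averaging operators *)

Section pair.
Context (d : measure_display) (T : measurableType d) (R : realType).
Variable P : probability T R.
Variables C1 C2 : nat -> T -> Z2.
Hypothesis hC1 : comb_walk P (0, 0)%R C1.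
Hypothesis hC2 : comb_walk P (0, 0)%R C2.
Hypothesis hindep : independent_processes P C1 C2.
Local Open Scope ereal_scope.

Let mC1 : is_process C1. Proof. by case: hC1. Qed.
Let mC2 : is_process C2. Proof. by case: hC2. Qed.

Let cyl n s1 s2 := history C1 n s1 `&` history C2 n s2.

Let mcyl n s1 s2 : measurable (cyl n s1 s2).
Proof. by apply: measurableI; exact: history_measurable. Qed.

Let cyl_prob n s1 s2 : P (cyl n s1 s2) = P (history C1 n s1) * P (history C2 n s2).
Proof. by apply: hindep; exact: history_process_sigma_algebra. Qed.

Let cyl_extend n s1 s2 a b :
  P (cyl n.+1 (extend n s1 a) (extend n s2 b)) =
    P (cyl n s1 s2) * (comb_prob R (s1 n) a * comb_prob R (s2 n) b)%:E.
Proof.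
case: hC1 => _ _ markov1; case: hC2 => _ _ markov2.
by rewrite !cyl_prob !history_extend markov1 markov2 muleACA EFinM.
Qed.

(** Conditioning on the next step: up to null sets the cylinder splits into its extensions by pairs
    of neighbours, whose probabilities multiply by independence. *)
Lemma pair_step n s1 s2 (A : set T) (F : Z2 * Z2 -> R) : measurable A ->
  (forall a b, P (cyl n.+1 (extend n s1 a) (extend n s2 b) `&` A) <=
     P (cyl n.+1 (extend n s1 a) (extend n s2 b)) * (F (a, b))%:E) ->
  P (cyl n s1 s2 `&` A) <= P (cyl n s1 s2) * (avg2 F (s1 n, s2 n))%:E.
Proof.
move=> mA hF.
have mX1 B : measurable (C1 n.+1 @^-1` B) by exact: mC1.
have mX2 B : measurable (C2 n.+1 @^-1` B) by exact: mC2.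
have mCA : measurable (cyl n s1 s2 `&` A) by exact: measurableI.
have null1 : P ((cyl n s1 s2 `&` A) `&`
    C1 n.+1 @^-1` [set v | v \notin nbrs (s1 n)]) = 0.
  apply: (@subset_measure0 _ _ _ _ _ _ _ _ _ (walk_step_null n s1 hC1)).
  - exact: measurableI.
  - by apply: measurableI => //; exact: history_measurable.
  - by move=> w [[[? _] _] ?].
have null2 a : P ((cyl n s1 s2 `&` A) `&` C1 n.+1 @^-1` [set a] `&`
    C2 n.+1 @^-1` [set v | v \notin nbrs (s2 n)]) = 0.
  apply: (@subset_measure0 _ _ _ _ _ _ _ _ _ (walk_step_null n s2 hC2)).
  - by apply: measurableI => //; exact: measurableI.
  - by apply: measurableI => //; exact: history_measurable.
  - by move=> w [[[[_ ?] _] _] ?].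
apply: le_trans (measure_le_fibres P (nbrs (s1 n)) mX1 mCA) _.
rewrite null1 adde0.
have -> : P (cyl n s1 s2) * (avg2 F (s1 n, s2 n))%:E =
    \sum_(a <- nbrs (s1 n)) \sum_(b <- nbrs (s2 n))
      P (cyl n s1 s2) * (comb_prob R (s1 n) a * comb_prob R (s2 n) b)%:E * (F (a, b))%:E.
  rewrite -(fineK (fin_num_measure P _ (mcyl n s1 s2))) /avg2 avgE /=.
  rewrite -EFinM mulr_sumr -sumEFin; apply: eq_bigr => a _.
  rewrite avgE !mulr_sumr -sumEFin; apply: eq_bigr => b _.
  by rewrite -!EFinM !mulrA.
apply: lee_sum => a _.
apply: le_trans (measure_le_fibres P (nbrs (s2 n)) mX2 _) _.
  exact: measurableI.
rewrite null2 adde0; apply: lee_sum => b _.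
rewrite -cyl_extend; apply: le_trans (hF a b).
rewrite le_eqVlt; apply/orP; left; apply/eqP; congr (P _).
rewrite /cyl !history_extend; apply/seteqP; split=> w; rewrite /setI /=; tauto.
Qed.

Lemma pair_event_measurable (E : pred (Z2 * Z2)) n :
  measurable [set w | E (C1 n w, C2 n w)].
Proof.
have -> : [set w | E (C1 n w, C2 n w)] = \bigcup_m
    (if unpickle m is Some u then C1 n @^-1` [set u] `&` C2 n @^-1` [set v | E (u, v)]
     else set0).
  apply/seteqP; split=> w /=.
    by move=> Ew; exists (pickle (C1 n w)); [exact: I | rewrite pickleK].
  by move=> [m _]; case: unpickle => [u [/= <-]|].
apply: bigcup_measurable => m _; case: unpickle => [u|] //.
by apply: measurableI; [exact: mC1 | exact: mC2].
Qed.

Lemma encounter_measurable E n k : measurable (encounter C1 C2 E n k).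
Proof.
have -> : encounter C1 C2 E n k =
    \bigcup_(i in [set i | (i <= k)%N]) [set w | E (C1 (n + i) w, C2 (n + i) w)].
  by apply/seteqP; split=> w /= [i ik Ei]; exists i.
by apply: bigcup_measurable => i _; exact: pair_event_measurable.
Qed.

(** The induction follows the recursion of [hit]: outside E an encounter can only happen from time n
    + 1 on. *)
Lemma cyl_encounter_le E k n s1 s2 :
  P (cyl n s1 s2 `&` encounter C1 C2 E n k) <=
    P (cyl n s1 s2) * (hit R E k (s1 n, s2 n))%:E.
Proof.
elim: k n s1 s2 => [|k IH] n s1 s2 /=; case: ifP => [_|Es].
- rewrite mule1; apply: le_measure; rewrite ?inE //.
  by apply: measurableI => //; exact: encounter_measurable.
- rewrite mule0 (_ : _ `&` _ = set0) ?measure0 //.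
  apply/seteqP; split=> w //= [[h1 h2] [i]]; rewrite leqn0 => /eqP ->.
  by rewrite addn0 h1 // h2 // Es.
- rewrite mule1; apply: le_measure; rewrite ?inE //.
  by apply: measurableI => //; exact: encounter_measurable.
rewrite (_ : _ `&` _ = cyl n s1 s2 `&` encounter C1 C2 E n.+1 k).
  apply: pair_step; first exact: encounter_measurable.
  move=> a b; apply: le_trans (IH _ _ _) _.
  by rewrite /extend ltnn.
apply/seteqP; split=> w [/= hw [i ik Ei]]; split=> //.
  case: i ik Ei => [_|i ik Ei]; last by exists i => //; rewrite addSnnS.
  by case: hw => h1 h2; rewrite addn0 h1 // h2 // Es.
by exists i.+1 => //; rewrite addnS -addSn.
Qed.

Lemma cyl_late_encounter_le E m k n s1 s2 :
  P (cyl n s1 s2 `&` encounter C1 C2 E (n + m) k) <=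
    P (cyl n s1 s2) * (iter m (@avg2 R) (hit R E k) (s1 n, s2 n))%:E.
Proof.
elim: m n s1 s2 => [|m IH] n s1 s2.
  by rewrite addn0; exact: cyl_encounter_le.
apply: pair_step; first exact: encounter_measurable.
by move=> a b; rewrite -addSnnS; apply: le_trans (IH _ _ _) _; rewrite /extend ltnn.
Qed.

Lemma encounter_le E m k :
  P (encounter C1 C2 E m k) <= (iter m (@avg2 R) (hit R E k) origin2)%:E.
Proof.
pose s0 (_ : nat) : Z2 := (0, 0)%R.
have c1 : P (cyl 0 s0 s0) = 1.
  rewrite cyl_prob !history0; case: hC1 => _ -> _; case: hC2 => _ -> _.
  by rewrite mule1.
have := cyl_late_encounter_le E m k 0 s0 s0.
rewrite c1 mul1e add0n; apply: le_trans.
have mE := encounter_measurable E m k.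
rewrite -[leRHS]adde0 -[X in _ + X](_ : P (~` cyl 0 s0 s0) = 0); last first.
  by rewrite probability_setC // c1 subee.
apply: le_trans (measureU2 _ _ _); last 2 first.
- exact: measurableI.
- exact: measurableC.
apply: le_measure; rewrite ?inE //.
  by apply: measurableU; [exact: measurableI | exact: measurableC].
by move=> w Ew; have [cw|cw] := pselect (cyl 0 s0 s0 w); [left|right].
Qed.

End pair.

(** * Summation over the windows and Borel-Cantelli *)

Lemma geometric_sum_le (R : realType) (x : R) n : 0 <= x -> x < 1 ->
  \sum_(k < n) x ^+ k <= (1 - x)^-1.
Proof.
move=> x0 x1; have x1' : 0 < 1 - x by lra.
rewrite -[leRHS]mul1r ler_pdivlMr //.
have := subrX1 x n; have := exprn_ge0 n x0; lra.
Qed.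

Lemma nneseries_geometric_lty (R : realType) (u : nat -> \bar R) (c x y : R) :
  0 <= c -> 0 <= x < 1 -> 0 <= y < 1 -> (forall k, 0 <= u k)%E ->
  (forall k, u k <= (c * (x ^+ k + y ^+ k))%:E)%E ->
  (\sum_(k <oo) u k < +oo)%E.
Proof.
move=> c0 /andP[x0 x1] /andP[y0 y1] u0 ule.
apply: le_lt_trans (ltry (c * ((1 - x)^-1 + (1 - y)^-1))).
apply: lime_le; first exact: is_cvg_nneseries.
apply: nearW => n; rewrite big_mkord.
apply: le_trans (_ : (\sum_(k < n) (c * (x ^+ k + y ^+ k))%:E <= _)%E).
  by apply: lee_sum => k _; exact: ule.
rewrite sumEFin lee_fin -mulr_sumr big_split /= ler_wpM2l // lerD //;
  exact: geometric_sum_le.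
Qed.

Lemma encounter_window_le d (T : measurableType d) (R : realType)
    (P : probability T R) (C1 C2 : nat -> T -> Z2) (s M : nat) :
  comb_walk P (0, 0) C1 -> comb_walk P (0, 0) C2 -> independent_processes P C1 C2 ->
  (0 < s)%N -> (0 < M)%N ->
  (P (encounter C1 C2 (close (s ^ 2)) (M ^ 4) (15 * M ^ 4)) <=
    (window_cst R * (s%:R ^+ 2 / M%:R + s%:R^-1))%:E)%E.
Proof.
move=> hC1 hC2 hind s0 M0.
have sR : 1 <= s%:R :> R by rewrite ler1n.
have MR : 0 < M%:R :> R by rewrite ltr0n.
case: (leqP (4 * s) M) => [sM|Ms].
  by apply: le_trans (encounter_le hC1 hC2 hind _ _ _) _; rewrite lee_fin hit_window_le.
(* When M < 4 s the bound is trivial: s^2/M >= 1/4 and the constant is at least 4. *)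
apply: le_trans (probability_le1 P (encounter_measurable hC1 hC2 _ _ _)) _.
rewrite lee_fin.
have c4 : 4 <= window_cst R.
  by rewrite /window_cst; lra.
have sM : 1 / 4 <= s%:R ^+ 2 / M%:R :> R.
  rewrite ler_pdivlMr //; have : M%:R <= 4 * s%:R :> R by rewrite -natrM ler_nat ltnW.
  nra.
have si : 0 <= s%:R^-1 :> R by rewrite invr_ge0 ler0n.
move: (window_cst R) c4 (s%:R ^+ 2 / M%:R) sM (s%:R^-1) si => c c4 a a4 b b0.
nra.
Qed.

Theorem theorem4p3 (d : measure_display) (T : measurableType d) (R : realType)
    (P : probability T R) (C1 C2 : nat -> T -> Z2)
    (hC1 : comb_walk P (0, 0) C1) (hC2 : comb_walk P (0, 0) C2)
    (hindep : independent_processes P C1 C2)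
    (eps : R) (heps : 0 < eps) :
  {ae P, forall w, exists n0 : nat, forall n : nat, (n0 <= n)%N ->
    n%:R `^ (1 / 4 - eps) < (comb_dist (C1 n w) (C2 n w))%:R}.
Proof.
(* For large eps the exponent is replaced by a larger one, so that it is positive. *)
have [a a_gt [a_lt a_eps]] : exists2 a : R, 0 < a & a < 1 / 4 /\ 1 / 4 - eps <= a.
  by case: (leP eps (1 / 8)) => h; [exists (1 / 4 - eps) | exists (1 / 8)];
    try split; lra.
(* Then q^2 = 16^a, so a radius s_k^2 above q^(2(k+1)) dominates n^a for all n < 16^(k+1); q^2 < 2
   expresses a < 1/4. *)
pose q : R := 2 `^ (2 * a).
have pow_gt1 (r : R) : 0 < r -> 1 < 2 `^ r.
  move=> r0; have e : 1 `^ r = 1 by rewrite powR1.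
  by rewrite -[ltLHS]e gt0_ltr_powR ?nnegrE // ltr1n.
have q1 : 1 < q by apply: pow_gt1; lra.
have qq : q ^+ 2 < 2.
  have e : q ^+ 2 * 2 `^ (1 - 4 * a) = 2.
    rewrite -powR_mulrn ?powR_ge0 // /q -powRrM -powRD; last by rewrite pnatr_eq0 implybT.
    by rewrite (_ : _ * _ + _ = 1) ?powRr1 //; lra.
  have : 1 < 2 `^ (1 - 4 * a) by apply: pow_gt1; lra.
  nra.
have q0 : 0 < q by lra.
pose s k := (Num.trunc (q ^+ k.+1)).+1.
have s_gt k : q ^+ k.+1 < (s k)%:R by exact: truncnS_gt.
have s_le k : (s k)%:R <= 2 * q ^+ k.+1.
  have h1 : 1 <= q ^+ k.+1 by rewrite exprn_ege1 // ltW.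
  have : (Num.trunc (q ^+ k.+1))%:R <= q ^+ k.+1 by rewrite truncn_le exprn_ge0 // ltW.
  by rewrite /s -natr1; lra.
pose F k := encounter C1 C2 (close (s k ^ 2)) ((2 ^ k) ^ 4) (15 * (2 ^ k) ^ 4).
have mF k : measurable (F k) by apply: (encounter_measurable hC1 hC2).
have F0 : P (lim_sup_set F) = 0%E.
  apply: lim_sup_set_cvg0 => //.
  (* With M = 2^k, s_k <= 2 q^(k+1) gives s_k^2/M <= 4 q^2 (q^2/2)^k <= 8 (q^2/2)^k, and s_k >
     q^(k+1) gives 1/s_k <= q^(-k). *)
  apply: (@nneseries_geometric_lty _ _ (8 * window_cst R) (q ^+ 2 / 2) (q^-1)).
  - by rewrite mulr_ge0 // /window_cst; lra.
  - by rewrite divr_ge0 ?exprn_ge0 ?ltr_pdivrMr ?mul1r // ltW.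
  - by rewrite invr_ge0 invf_lt1 // q1 ltW.
  - by move=> k; exact: measure_ge0.
  move=> k; apply: le_trans (encounter_window_le hC1 hC2 hindep _ _) _ => //.
    by rewrite expn_gt0.
  rewrite lee_fin -mulrA mulrCA ler_wpM2l //; first by rewrite /window_cst; lra.
  rewrite mulrDr natrX; apply: lerD.
    rewrite expr_div_n mulrA ler_pM2r ?invr_gt0 ?exprn_gt0 //.
    apply: le_trans (_ : (2 * q ^+ k.+1) ^+ 2 <= _).
      by rewrite ler_sqr ?nnegrE ?mulr_ge0 ?exprn_ge0 ?ler0n // ltW.
    rewrite exprMn exprAC [_ ^+ k.+1]exprS.
    have := exprn_ge0 k (sqr_ge0 q); nra.
  rewrite exprVn; apply: le_trans (_ : (q ^+ k)^-1 <= _).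
    rewrite lef_pV2 ?posrE ?exprn_gt0 ?ltr0n //.
    apply: le_trans (ltW (s_gt k)); rewrite exprS ler_peMl ?exprn_ge0 ?ltW //.
  by rewrite ler_peMl ?invr_ge0 ?exprn_ge0 ?ltW //; lra.
exists (lim_sup_set F); split => //.
  apply: bigcap_measurable; first by exists 0%N.
  by move=> k _; apply: bigcup_measurable.
move=> w; apply: contra_notP => /= nF.
have [k0 hk0] : exists k0, forall k, (k0 <= k)%N -> ~ F k w.
  apply: contra_notP nF => /forallNP h n _.
  have /existsNP[k /not_implyP[nk /contrapT Fk]] := h n.
  by exists k.
exists (16 ^ k0)%N => n hn; rewrite ltNge; apply/negP => Dn.
(* The window [16^k, 16^(k+1)) contains n; a distance at most n^a would be an encounter in [F k]. *)
pose k := trunc_log 16 n.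
have n0 : (0 < n)%N by apply: leq_trans hn; rewrite expn_gt0.
have nk : (16 ^ k <= n)%N by exact: trunc_logP.
have nk1 : (n < 16 ^ k.+1)%N by exact: trunc_log_ltn.
apply: (hk0 k); first exact: trunc_log_max.
have e16 : ((2 ^ k) ^ 4 = 16 ^ k)%N by rewrite -expnM mulnC expnM.
exists (n - 16 ^ k)%N; first by rewrite e16; rewrite expnS in nk1; lia.
rewrite e16 subnKC // /close /=.
rewrite -(ler_nat R) natrX; apply: le_trans Dn _.
have n1 : 1 <= n%:R :> R by rewrite ler1n.
apply: le_trans (ler_powR n1 a_eps) _.
apply: le_trans (_ : ((16 ^ k.+1)%N%:R) `^ a <= _).
  by apply: ge0_ler_powR; rewrite ?nnegrE ?ler0n ?ler_nat ?(ltW a_gt) ?(ltnW nk1).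
have pow2 (m : nat) : (2 ^ m)%N%:R = 2 `^ m%:R :> R by rewrite natrX powR_mulrn.
have powq (m : nat) : q ^+ m = 2 `^ (2 * a * m%:R).
  by rewrite powRrM powR_mulrn // powR_ge0.
have -> : ((16 ^ k.+1)%N%:R) `^ a = (q ^+ k.+1) ^+ 2.
  have -> : (16 ^ k.+1 = 2 ^ (4 * k.+1))%N by rewrite expnM.
  by rewrite -exprM powq pow2 -powRrM; congr powR; rewrite !natrM; lra.
by rewrite ler_sqr ?nnegrE ?exprn_ge0 ?ler0n ?(ltW q0) ?(ltW (s_gt k)).
Qed.
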